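(* Let $X$ be a Noetherian $\mathbb{F}_1$-scheme with counting function $N=N_X$ (canonically extended to $[1,\infty)$). Let $\zeta_N(s)$ and $\zeta_N^{\rm disc}(s)$ be the functions defined (up to a multiplicative constant) by $$\frac{\partial_s\zeta_N(s)}{\zeta_N(s)}=-\int_1^\infty N(u)\,u^{-s}\frac{du}{u},\qquad \frac{\partial_s\zeta_N^{\rm disc}(s)}{\zeta_N^{\rm disc}(s)}=-\sum_{n\ge1}N(n)\,n^{-s-1}$$ (for $\Re(s)$ large). Then replacing the integral by the sum in the definition of the logarithmic derivative does not alter the singularities of the zeta function associated to $X$; in fact, the ratio of the two zeta functions $\zeta_N(s)$ and $\zeta_N^{\rm disc}(s)$ is the exponential of an entire function.
   Context: Monoids. $\mathfrak{Mo}$ is the category of commutative monoids with unit $1$ and absorbing element $0\neq 1$. For an abelian group $H$, $\mathbb{F}_1[H]=H\cup\{0\}$; $\mathbb{F}_{1^n}=\mathbb{F}_1[\mathbb{Z}/n\mathbb{Z}]$. A geometric $\mathfrak{Mo}$-scheme is a topological space with a sheaf of such monoids which admits an open cover by prime spectra $\mathrm{Spec}(M)$ (set of prime ideals, topology and structure sheaf defined as for rings); morphisms are required to be local on stalks, i.e. stalk maps $\rho$ satisfy $\rho^{-1}(\text{units})=\text{units}$. An $\mathfrak{Mo}$-scheme is a functor $\mathfrak{Mo}\to\mathfrak{Sets}$ admitting an open cover by representable sub-functors; it is equivalent to a geometric $\mathfrak{Mo}$-scheme $X$, via $M\mapsto\mathrm{Hom}(\mathrm{Spec}\,M,X)$.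 $\mathbb{F}_1$-schemes. Let $\beta:\mathfrak{Mo}\to\mathfrak{Ring}$, $\beta(M)=\mathbb{Z}[M]$ (with the zero of $M$ identified with $0$), and its right adjoint $\beta^*:\mathfrak{Ring}\to\mathfrak{Mo}$, $\beta^*(R)=R$ (multiplicative monoid). Let $\mathfrak{MR}=\mathfrak{Ring}\cup_{\beta,\beta^*}\mathfrak{Mo}$ be the category glued along this adjunction (objects of both; morphisms within each; and $\mathrm{Hom}(M,R)=\mathrm{Hom}_{\mathfrak{Mo}}(M,\beta^*(R))\cong\mathrm{Hom}_{\mathfrak{Ring}}(\beta(M),R)$, no morphisms from rings to monoids). An $\mathbb{F}_1$-scheme is a covariant functor $\mathcal X:\mathfrak{MR}\to\mathfrak{Sets}$ whose restriction $X_{\mathbb{Z}}$ to $\mathfrak{Ring}$ is a $\mathbb{Z}$-scheme, whose restriction $\underline X$ to $\mathfrak{Mo}$ is an $\mathfrak{Mo}$-scheme, and such that the natural transformation $e:\underline X\circ\beta^*\to X_{\mathbb{Z}}$ evaluated at any field is a bijection. It is Noetherian if $X_{\mathbb{Z}}$ and the $\mathfrak{Mo}$-scheme are Noetherian, the latter meaning that there is a finite open cover by spectra of Noetherian (equivalently finitely generated) monoids. $X$ denotes the geometric $\mathfrak{Mo}$-scheme which is the geometric realization of $\underline X$, and one refers to $X$ as the $\mathbb{F}_1$-scheme; $\mathcal O_{X,x}^\times$ is the group of invertible elements of the stalk $\mathcal O_{X,x}$. Counting function. $N_X(n+1)=\#X(\mathbb{F}_{1^n})=\#\mathrm{Hom}(\mathrm{Spec}\,\mathbb{F}_{1^n},X)=\sum_{x\in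 X}\#\mathrm{Hom}(\mathcal O_{X,x}^\times,\mathbb{Z}/n\mathbb{Z})$. It extends to a function on $\mathbb{Z}$ of the form $\sum_jT_j(n)n^j$ (finite sum, $T_j$ periodic). Any real function of this form has a canonical extension to an entire function $N(z)=f(z)+\cos(\pi z)Q(z)$, obtained by writing $T_j(n)=\sum_{\alpha\in I}t_{j,\alpha}e^{2\pi i\alpha n}+s_j(-1)^n$ with $I\subset(-\frac12,\frac12)$ a finite set of rationals, and setting $f(z)=\sum_j\sum_\alpha t_{j,\alpha}e^{2\pi i\alpha z}z^j$, $Q(z)=\sum_js_jz^j$. $N_X(u)$ for real $u\ge1$, and in particular $N_X(1)$, are the values of this extension. *)

(* Defs.v *)
From mathcomp Require Import all_boot all_algebra.
From Stdlib Require Import FunctionalExtensionality ProofIrrelevance.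
From Stdlib Require Import QArith Qreals Reals.
From Coquelicot Require Import Coquelicot.

Set Implicit Arguments.
Unset Strict Implicit.
Unset Printing Implicit Defensive.

Record category := Category {
  obj :> Type;
  hom : obj -> obj -> Type;
  idm : forall a, hom a a;
  comp : forall a b c, hom b c -> hom a b -> hom a c;
  comp_idl : forall a b (f : hom a b), comp (idm b) f = f;
  comp_idr : forall a b (f : hom a b), comp f (idm a) = f;
  comp_assoc : forall a b c d (h : hom c d) (g : hom b c) (f : hom a b),
    comp h (comp g f) = comp (comp h g) f }.

Record functor (C : category) := Functor {
  fobj :> C -> Type;
  fmap : forall a b, hom a b -> fobj a -> fobj b;
  fmap_id : forall a x, fmap (idm a) x = x;
  fmap_comp : forall a b c (g : hom b c) (f : hom a b) x,
    fmap (comp g f) x = fmap g (fmap f x) }.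

Record subfunctor (C : category) (F : functor C) := SubFunctor {
  in_sub :> forall a, F a -> Prop;
  in_sub_map : forall a b (f : hom a b) x, in_sub x -> in_sub (fmap f x) }.

(* U is isomorphic, as a functor, to Hom(a, -). *)
Definition represented_by (C : category) (F : functor C) (U : subfunctor F)
    (a : C) : Prop :=
  exists phi : forall b, hom a b -> F b,
    [/\ forall b c (g : hom b c) (f : hom a b),
          phi c (comp g f) = fmap g (phi b f),
        forall b, injective (phi b)
      & forall b (x : F b), U b x <-> exists f, phi b f = x].

Section Algebra.
Import GRing.Theory.
Local Open Scope ring_scope.

Lemma rmorphism_ext (A B : comPzRingType) (f g : {rmorphism A -> B}) :
  f =1 g -> f = g.
Proof.
case: f g => f [[pf] [mf]] [g [[pg] [mg]]] /= e.
have E : f = g by apply: functional_extensionality.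
rewrite {e}; case: g / E pg mg => pg mg.
by rewrite (proof_irrelevance _ pf pg) (proof_irrelevance _ mf mg).
Qed.

(* [comPzRingType] includes the zero ring. *)
Definition Ring_cat : category.
Proof.
refine (@Category comPzRingType (fun A B => {rmorphism A -> B})
  (fun A => idfun : {rmorphism A -> A})
  (fun A B C (g : {rmorphism B -> C}) (f : {rmorphism A -> B}) =>
     g \o f : {rmorphism A -> C}) _ _ _);
by move=> *; apply: rmorphism_ext.
Defined.

Record mo := Mo {
  mo_car :> Type;
  mo_mul : mo_car -> mo_car -> mo_car;
  mo_one : mo_car;
  mo_zero : mo_car;
  mo_mulA : associative mo_mul;
  mo_mulC : commutative mo_mul;
  mo_mul1 : left_id mo_one mo_mul;
  mo_mul0 : left_zero mo_zero mo_mul;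
  mo_zero_neq_one : mo_zero <> mo_one }.

Arguments mo_mul {m}.
Arguments mo_one {m}.
Arguments mo_zero {m}.

Record mo_hom (M N : mo) := MoHom {
  mo_hom_fun :> M -> N;
  mo_hom1 : mo_hom_fun mo_one = mo_one;
  mo_hom0 : mo_hom_fun mo_zero = mo_zero;
  mo_homM : forall x y,
    mo_hom_fun (mo_mul x y) = mo_mul (mo_hom_fun x) (mo_hom_fun y) }.

Lemma mo_hom_ext (M N : mo) (f g : mo_hom M N) : f =1 g -> f = g.
Proof.
case: f g => f f1 f0 fM [g g1 g0 gM] /= e.
have E : f = g by apply: functional_extensionality.
rewrite {e}; case: g / E g1 g0 gM => g1 g0 gM.
by congr MoHom; apply: proof_irrelevance.
Qed.

Definition mo_id (M : mo) : mo_hom M M :=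
  @MoHom M M (fun x => x) erefl erefl (fun _ _ => erefl).

Definition mo_comp (M N P : mo) (g : mo_hom N P) (f : mo_hom M N) :
  mo_hom M P.
Proof.
apply: (@MoHom M P (fun x => g (f x))).
- by rewrite !mo_hom1.
- by rewrite !mo_hom0.
- by move=> x y; rewrite !mo_homM.
Defined.

Definition Mo_cat : category.
Proof.
refine (@Category mo mo_hom mo_id mo_comp _ _ _);
by move=> *; apply: mo_hom_ext.
Defined.

(* Morphisms from a monoid to the multiplicative monoid of a ring; the target
   may be the zero ring, whose multiplicative monoid is not in [mo]. *)
Record mr_hom (M : mo) (R : comPzRingType) := MRHom {
  mr_hom_fun :> M -> R;
  mr_hom1 : mr_hom_fun mo_one = 1;
  mr_hom0 : mr_hom_fun mo_zero = 0;
  mr_homM : forall x y, mr_hom_fun (mo_mul x y) = mr_hom_fun x * mr_hom_fun y }.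

Lemma mr_hom_ext (M : mo) (R : comPzRingType) (f g : mr_hom M R) :
  f =1 g -> f = g.
Proof.
case: f g => f f1 f0 fM [g g1 g0 gM] /= e.
have E : f = g by apply: functional_extensionality.
rewrite {e}; case: g / E g1 g0 gM => g1 g0 gM.
by congr MRHom; apply: proof_irrelevance.
Qed.

Definition mr_compl (M N : mo) (R : comPzRingType) (g : mr_hom N R)
  (f : mo_hom M N) : mr_hom M R.
Proof.
apply: (@MRHom M R (fun x => g (f x))).
- by rewrite mo_hom1 mr_hom1.
- by rewrite mo_hom0 mr_hom0.
- by move=> x y; rewrite mo_homM mr_homM.
Defined.

Definition mr_compr (M : mo) (R S : comPzRingType) (g : {rmorphism R -> S})
  (f : mr_hom M R) : mr_hom M S.
Proof.
apply: (@MRHom M S (fun x => g (f x))).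
- by rewrite mr_hom1 rmorph1.
- by rewrite mr_hom0 rmorph0.
- by move=> x y; rewrite mr_homM rmorphM.
Defined.

Inductive MR_obj := MR_ring of comPzRingType | MR_mo of mo.

Definition MR_hom (a b : MR_obj) : Type :=
  match a, b with
  | MR_ring R, MR_ring R' => {rmorphism R -> R'}
  | MR_mo M, MR_mo N => mo_hom M N
  | MR_mo M, MR_ring R => mr_hom M R
  | MR_ring _, MR_mo _ => Empty_set
  end.

Definition MR_id (a : MR_obj) : MR_hom a a :=
  match a with
  | MR_ring R => idm (R : Ring_cat)
  | MR_mo M => mo_id M
  end.

Definition MR_comp (a b c : MR_obj) : MR_hom b c -> MR_hom a b -> MR_hom a c.
Proof.
case: a b c => [A|A] [B|B] [C|C] //=.
- exact: (@comp Ring_cat A B C).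
- exact: mr_compr.
- exact: mr_compl.
- exact: mo_comp.
Defined.

Definition MR_cat : category.
Proof.
refine (@Category MR_obj MR_hom MR_id MR_comp _ _ _).
- by case=> A [] B // f; [exact: (@comp_idl Ring_cat) | exact: mr_hom_ext
    | exact: mo_hom_ext].
- by case=> A [] B // f; [exact: (@comp_idr Ring_cat) | exact: mr_hom_ext
    | exact: mo_hom_ext].
- case=> A [] B [] C [] D // h g f; first exact: (@comp_assoc Ring_cat).
  + exact: mr_hom_ext.
  + exact: mr_hom_ext.
  + exact: mr_hom_ext.
  + exact: mo_hom_ext.
Defined.

Definition restr_ring (X : functor MR_cat) : functor Ring_cat :=
  @Functor Ring_cat (fun A => X (MR_ring A))
    (fun A B f => @fmap MR_cat X (MR_ring A) (MR_ring B) f)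
    (fun A => @fmap_id MR_cat X (MR_ring A))
    (fun A B C => @fmap_comp MR_cat X (MR_ring A) (MR_ring B) (MR_ring C)).

Definition restr_mo (X : functor MR_cat) : functor Mo_cat :=
  @Functor Mo_cat (fun M => X (MR_mo M))
    (fun M N f => @fmap MR_cat X (MR_mo M) (MR_mo N) f)
    (fun M => @fmap_id MR_cat X (MR_mo M))
    (fun M N P => @fmap_comp MR_cat X (MR_mo M) (MR_mo N) (MR_mo P)).

Definition beta_star (R : comNzRingType) : mo :=
  @Mo R *%R 1 0 (@mulrA R) (@mulrC R) (@mul1r R) (@mul0r R)
    (fun e : 0 = 1 :> R => negP (oner_neq0 R) (introT eqP (esym e))).

Definition beta_star_counit (R : comNzRingType) : mr_hom (beta_star R) R :=
  @MRHom (beta_star R) R (fun x => x) erefl erefl (fun _ _ => erefl).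

Definition mor_e (X : functor MR_cat) (R : comNzRingType) :
    restr_mo X (beta_star R) -> restr_ring X R :=
  @fmap MR_cat X (MR_mo (beta_star R)) (MR_ring R) (beta_star_counit R).

Definition F1_mul (H : zmodType) (x y : option H) : option H :=
  if x is Some a then if y is Some b then Some (a + b) else None else None.

(* F_1[H] = H together with an absorbing element; H is written additively. *)
Definition F1 (H : zmodType) : mo.
Proof.
refine (@Mo (option H) (@F1_mul H) (Some 0) None _ _ _ _ _).
- by move=> [a|] [b|] [c|] //=; rewrite addrA.
- by move=> [a|] [b|] //=; rewrite addrC.
- by move=> [a|] //=; rewrite add0r.
- by [].
- by [].
Defined.

(* Z-schemes, as functors of points. *)

Definition ring_ideal (A : comPzRingType) (I : A -> Prop) : Prop :=
  [/\ I 0, forall x y, I x -> I y -> I (x + y) & forall a x, I x -> I (a * x)].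

(* f(I)B = B *)
Definition ring_generates (A B : comPzRingType) (I : A -> Prop)
    (f : {rmorphism A -> B}) : Prop :=
  exists n (a : 'I_n -> A) (b : 'I_n -> B),
    (forall i, I (a i)) /\ \sum_i b i * f (a i) = 1.

Definition ring_noetherian (A : comPzRingType) : Prop :=
  forall I : A -> Prop, ring_ideal I ->
    exists n (g : 'I_n -> A),
      forall x, I x <-> exists c : 'I_n -> A, x = \sum_i c i * g i.

Definition ring_open (F : functor Ring_cat) (U : subfunctor F) : Prop :=
  forall (A : comPzRingType) (x : F A),
    exists2 I : A -> Prop, ring_ideal I &
      forall (B : comPzRingType) (f : {rmorphism A -> B}),
        U B (@fmap Ring_cat F A B f x) <-> ring_generates I f.

Definition ring_affine_cover (P : comPzRingType -> Prop)
    (F : functor Ring_cat) (J : Type) (U : J -> subfunctor F) : Prop :=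
  [/\ forall j, ring_open (U j),
      forall j, exists2 A : comPzRingType, P A & represented_by (U j) A
    & forall (K : fieldType) (x : F K), exists j, U j K x].

Definition ring_unit (A : comPzRingType) (a : A) : Prop := exists b, a * b = 1.

Definition is_localization (A B : comPzRingType) (f : A)
    (l : {rmorphism A -> B}) : Prop :=
  ring_unit (l f) /\
  forall (C : comPzRingType) (g : {rmorphism A -> C}), ring_unit (g f) ->
    exists! h : {rmorphism B -> C}, forall a, h (l a) = g a.

(* F is a sheaf for the Zariski topology: if the f_i generate the unit ideal,
   F(A) -> prod F(A_{f_i}) => prod F(A_{f_i f_j}) is exact. *)
Definition zariski_local (F : functor Ring_cat) : Prop :=
  forall (A : comPzRingType) n (f c : 'I_n -> A), \sum_i c i * f i = 1 ->
  forall (Af : 'I_n -> comPzRingType) (l : forall i, {rmorphism A -> Af i})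
    (Aff : 'I_n -> 'I_n -> comPzRingType)
    (ll : forall i j, {rmorphism A -> Aff i j})
    (r : forall i j, {rmorphism Af i -> Aff i j})
    (r' : forall i j, {rmorphism Af j -> Aff i j}),
  (forall i, is_localization (f i) (l i)) ->
  (forall i j, is_localization (f i * f j) (ll i j)) ->
  (forall i j a, r i j (l i a) = ll i j a) ->
  (forall i j a, r' i j (l j a) = ll i j a) ->
  forall x : forall i, F (Af i),
  (forall i j, @fmap Ring_cat F (Af i) (Aff i j) (r i j) (x i) =
               @fmap Ring_cat F (Af j) (Aff i j) (r' i j) (x j)) ->
  exists! y : F A, forall i, @fmap Ring_cat F A (Af i) (l i) y = x i.

Definition Z_scheme (F : functor Ring_cat) : Prop :=
  zariski_local F /\
  exists (J : Type) (U : J -> subfunctor F),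
    ring_affine_cover (fun=> True) U.

Definition Z_scheme_noetherian (F : functor Ring_cat) : Prop :=
  Z_scheme F /\
  exists n (U : 'I_n -> subfunctor F), ring_affine_cover ring_noetherian U.

(* Mo-schemes.  No sheaf condition is needed: the spectrum of a monoid has a
   unique closed point, hence every open cover of it is trivial. *)

Definition mo_ideal (M : mo) (I : M -> Prop) : Prop :=
  I mo_zero /\ forall a x, I x -> I (mo_mul a x).

(* f(I)N = N *)
Definition mo_generates (M N : mo) (I : M -> Prop) (f : mo_hom M N) : Prop :=
  exists a b, I a /\ mo_mul b (f a) = mo_one.

Definition mo_fg (M : mo) : Prop :=
  exists n (g : 'I_n -> M),
    forall P : M -> Prop, P mo_zero -> P mo_one ->
      (forall x y, P x -> P y -> P (mo_mul x y)) -> (forall i, P (g i)) ->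
      forall x, P x.

Definition mo_open (F : functor Mo_cat) (U : subfunctor F) : Prop :=
  forall (M : mo) (x : F M),
    exists2 I : M -> Prop, mo_ideal I &
      forall (N : mo) (f : mo_hom M N),
        U N (@fmap Mo_cat F M N f x) <-> mo_generates I f.

(* The monoids F_1[H] play the role of fields: for open subfunctors, covering
   F on these is equivalent to covering F on every monoid. *)
Definition mo_affine_cover (P : mo -> Prop)
    (F : functor Mo_cat) (J : Type) (U : J -> subfunctor F) : Prop :=
  [/\ forall j, mo_open (U j),
      forall j, exists2 M : mo, P M & represented_by (U j) M
    & forall (H : zmodType) (x : F (F1 H)), exists j, U j (F1 H) x].

Definition Mo_scheme (F : functor Mo_cat) : Prop :=
  exists (J : Type) (U : J -> subfunctor F), mo_affine_cover (fun=> True) U.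

Definition Mo_scheme_noetherian (F : functor Mo_cat) : Prop :=
  exists n (U : 'I_n -> subfunctor F), mo_affine_cover mo_fg U.

Definition F1_scheme (X : functor MR_cat) : Prop :=
  [/\ Z_scheme (restr_ring X),
      Mo_scheme (restr_mo X)
    & forall K : fieldType, bijective (@mor_e X K)].

Definition F1_noetherian (X : functor MR_cat) : Prop :=
  Z_scheme_noetherian (restr_ring X) /\ Mo_scheme_noetherian (restr_mo X).

Definition has_card (T : Type) (k : nat) : Prop :=
  exists f : 'I_k -> T, bijective f.

(* #X(F_{1^n}) = k for n = m + 1; ['I_m.+1] is the additive group Z/nZ. *)
Definition F1n_points (X : functor MR_cat) (m k : nat) : Prop :=
  has_card (restr_mo X (F1 'I_m.+1)) k.

End Algebra.

Section Analysis.
Local Open Scope R_scope.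
Local Open Scope C_scope.

Definition Cexp (z : C) : C :=
  (exp (Re z) * cos (Im z), exp (Re z) * sin (Im z))%R.

Definition Ccos (z : C) : C := (Cexp (Ci * z) + Cexp (- (Ci * z))) / 2.

Definition periodic (T : Z -> R) : Prop :=
  exists2 p : Z, (0 < p)%Z & forall n, T (n + p)%Z = T n.

(* M(n) = sum_(j <= d) T_j(n) n^j *)
Definition quasi_polynomial (d : nat) (T : nat -> Z -> R) (M : Z -> R) : Prop :=
  (forall j, periodic (T j)) /\
  forall n, M n = (\big[Rplus/0]_(j < d.+1) (T j n * IZR n ^ j))%R.

(* N is the entire function f(z) + cos(pi z) Q(z) attached to M.  This function
   depends only on M, and M(n + 1) is sent to N(z + 1). *)
Definition canonical_extension (M : Z -> R) (N : C -> C) : Prop :=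
  exists (d : nat) (T : nat -> Z -> R) (I : list Q)
         (t : nat -> Q -> C) (s : nat -> C),
    [/\ quasi_polynomial d T M,
        forall a, List.In a I -> (- (1 / 2) < Q2R a < 1 / 2)%R,
        forall (j : nat) (n : Z), leq j d ->
          RtoC (T j n) =
            \big[Cplus/RtoC 0]_(a <- I)
              (t j a * Cexp (2 * PI * Ci * Q2R a * IZR n))
            + s j * powerRZ (-1) n
      & forall z, N z =
          \big[Cplus/RtoC 0]_(j < d.+1) \big[Cplus/RtoC 0]_(a <- I)
            (t j a * Cexp (2 * PI * Ci * Q2R a * z) * z ^ j)
          + Ccos (PI * z) * \big[Cplus/RtoC 0]_(j < d.+1) (s j * z ^ j)].

(* N is the canonical extension of N_X, where N_X(n + 1) = #X(F_{1^n}) for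
   n >= 1; below n = m + 1. *)
Definition counting_function (X : functor MR_cat) (N : C -> C) : Prop :=
  exists2 M : Z -> R,
    forall m, exists2 k : nat, F1n_points X m k & M (Z.of_nat m.+2) = INR k
    & canonical_extension M N.

Definition C_is_derive (f : C -> C) (z l : C) : Prop :=
  @is_derive C_AbsRing C_NormedModule f z l.

Definition C_ex_derive (f : C -> C) (z : C) : Prop := exists l, C_is_derive f z l.

Definition entire (f : C -> C) : Prop := forall z, C_ex_derive f z.

(* P holds for Re(s) large. *)
Definition Re_large (P : C -> Prop) : Prop :=
  exists A : R, forall s, (A < Re s)%R -> P s.

(* x^s for x > 0 *)
Definition Rcpow (x : R) (s : C) : C := Cexp (s * ln x).

Definition is_zeta (N : C -> C) (zeta : C -> C) : Prop :=
  Re_large (fun s => zeta s <> 0 /\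
    exists dzeta l : C,
      [/\ C_is_derive zeta s dzeta,
          @is_RInt_gen C_R_NormedModule (fun u : R => N u * Rcpow u (- s) / u)
            (at_point 1%R) (Rbar_locally p_infty) l
        & dzeta / zeta s = - l]).

Definition is_zeta_disc (N : C -> C) (zeta : C -> C) : Prop :=
  Re_large (fun s => zeta s <> 0 /\
    exists dzeta l : C,
      [/\ C_is_derive zeta s dzeta,
          @is_series C_AbsRing C_NormedModule
            (fun n : nat => N (INR n.+1) * Rcpow (INR n.+1) (- s - 1)) l
        & dzeta / zeta s = - l]).

(* Analytic continuation of f along the path g, over the parameters t in D:
   F t is a holomorphic germ at g t, the germ at g 0 being that of f. *)
Definition continuation (D : R -> Prop) (f : C -> C) (g : R -> C)
    (F : R -> C -> C) : Prop :=
  [/\ locally (g 0%R) (fun s => F 0%R s = f s),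
      forall t, D t -> locally (g t) (C_ex_derive (F t))
    & forall t, D t ->
        locally t (fun u => D u -> locally (g u) (fun s => F u s = F t s))].

(* Following g from g 0 to g 1, the continuation of f first becomes singular
   at the endpoint g 1. *)
Definition singular_end (f : C -> C) (g : R -> C) : Prop :=
  (exists F, continuation (fun t => 0 <= t < 1)%R f g F) /\
  ~ (exists F, continuation (fun t => 0 <= t <= 1)%R f g F).

(* f and f', both given for Re(s) large, have the same singularities on every
   branch of their analytic continuations. *)
Definition same_singularities (f f' : C -> C) : Prop :=
  Re_large (fun s => forall g : R -> C, (forall t, continuous g t) ->
    g 0%R = s -> (singular_end f g <-> singular_end f' g)).

End Analysis.

(* Main.v *)
Require Import Defs.
From HB Require Import structures.
From mathcomp Require Import all_boot all_algebra.
From Stdlib Require Import Reals Lra Lia Qreals ClassicalEpsilon.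
From Coquelicot Require Import Coquelicot.

(** Put w = s + 1 - j. Up to a scalar, a term e^(i theta u) u^j of the counting
function contributes to the difference of the two logarithmic derivatives the
quantity

  D(w) = sum over m >= 1 of z^m (m^-w - integral over 0 <= t <= 1 of
           e^(i theta t) (m + t)^-w dt),      z = e^(i theta),

and everything rests on the fact that D, defined for Re w large, extends to an
entire function with an entire primitive. The series and the integral may each
have a pole (both do when theta = 0, at w = 1, the pole of the Riemann zeta
function), but the poles cancel.

The reason is repeated summation by parts, in a family stable under it: the sums
of z^m (p psi(m) + integral of b(t) psi(m + t) dt), with p a number and b a
continuous weight ([cell_sum]). If B is an antiderivative of b with
B(1) = z (B(0) - p), the boundary terms telescope and the sum for (p, b, psi)
becomes an explicit constant minus the sum for (0, B, psi') ([cell_by_parts]).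
Such a B exists when z <> 1; when z = 1 it requires p + integral of b = 0, and the
free constant in B then serves to restore this condition for (0, B)
([balanced_antiderivative]). The frequencies of a canonical extension satisfy
|theta| < 2 pi, so z = 1 only for theta = 0, where p = 1 and b = -1 meet the
condition ([phase_balanced]). Since psi = u^-w has derivative -w u^(-w-1), each
step gains one unit in the real part of w.

Instead of continuing D step by step to the left, its Taylor coefficients at a real
point c are followed: they are the same sums with
psi = (- ln u)^k / k! * u^-c. One step expresses the coefficients at c for (p, b)
through those at c + 1 for (0, B), so the expansion converges in a disc reaching
one unit further; after all steps the coefficients decrease faster than any
geometric sequence ([moments_expansion]). An entire power series can be integrated
termwise ([power_series_primitive]), which gives the primitive of D
([cell_sum_primitive]).

By linearity the difference of the logarithmic derivatives is h' for an entire h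
([entire_gap_canonical_extension]), so zeta / zeta_disc * e^(-h) has derivative 0
on a half-plane and is a nonzero constant there. Multiplying continuations along a
path by e^h or e^(-h) exchanges those of the two functions, hence their
singularities ([singular_end_mult_Cexp]). *)

Set Implicit Arguments.
Unset Strict Implicit.
Unset Printing Implicit Defensive.

Local Open Scope R_scope.

Local Notation is_derC f x l := (@is_derive R_AbsRing C_R_NormedModule f x l).
Local Notation is_intC f a b l := (@is_RInt C_R_NormedModule f a b l).
Local Notation contC f x := (@continuous R_UniformSpace C_UniformSpace f x).

(** * Finite sums and moduli *)

HB.instance Definition _ :=
  Monoid.isComLaw.Build C (RtoC 0) Cplus Cplus_assoc Cplus_comm Cplus_0_l.
HB.instance Definition _ := Monoid.isMulLaw.Build C (RtoC 0) Cmult Cmult_0_l Cmult_0_r.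
HB.instance Definition _ :=
  Monoid.isAddLaw.Build C Cmult Cplus Cmult_plus_distr_r Cmult_plus_distr_l.
HB.instance Definition _ :=
  Monoid.isComLaw.Build R 0 Rplus (fun x y z => esym (Rplus_assoc x y z)) Rplus_comm Rplus_0_l.
HB.instance Definition _ := Monoid.isMulLaw.Build R 0 Rmult Rmult_0_l Rmult_0_r.
HB.instance Definition _ :=
  Monoid.isAddLaw.Build R Rmult Rplus Rmult_plus_distr_r Rmult_plus_distr_l.

Lemma Cmod_sum n (f : 'I_n -> C) :
  Cmod (\big[Cplus/RtoC 0]_(k < n) f k) <= \big[Rplus/0]_(k < n) Cmod (f k).
Proof.
apply: (big_ind2 (fun x y => Cmod x <= y)).
- by rewrite Cmod_0; lra.
- by move=> x a y b; have := Cmod_triangle x y; lra.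
- by move=> *; lra.
Qed.

Lemma Cmod_minus_sym (x y : C) : Cmod (x - y) = Cmod (y - x).
Proof. by rewrite -Cmod_opp; congr Cmod; ring. Qed.

Lemma Cmod_triangle_sub (x y : C) : Cmod (x - y) <= Cmod x + Cmod y.
Proof. by have := Cmod_triangle x (- y); rewrite Cmod_opp. Qed.

(** * Derivatives over C and along real paths *)

(** C carries two uniform structures, one from its modulus and one from R x R; the
epsilon-delta form avoids transporting filters between them. *)
Lemma C_is_deriveP (f : C -> C) (z l : C) :
  C_is_derive f z l <->
  forall eps, 0 < eps -> exists2 d, 0 < d & forall h : C, Cmod h < d ->
    Cmod (f (z + h) - f z - h * l)%C <= eps * Cmod h.
Proof.
split.
- move=> [_ H] eps e0.
  have [d Hd] : locally (z : C_AbsRing)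
      (fun y : C_AbsRing => Cmod (f y - f z - (y - z) * l)%C <= eps * Cmod (y - z)%C).
    exact: (H z (fun P HP => HP) (mkposreal eps e0)).
  exists d; first exact: cond_pos.
  move=> h hd.
  have E : (z + h - z = h)%C by ring.
  have := Hd (z + h)%C; rewrite E; apply.
  by rewrite /ball /= /AbsRing_ball /abs /minus /plus /opp /= -/(Cminus (z + h)%C z) E.
- move=> H; split.
    exact: (@is_linear_scal_l C_AbsRing C_NormedModule).
  move=> x Hx eps.
  have -> : x = z.
    by symmetry; apply: (@is_filter_lim_locally_unique C_AbsRing (AbsRing_NormedModule C_AbsRing)).
  have [d d0 Hd] := H eps (cond_pos eps).
  exists (mkposreal d d0) => y By.
  have := Hd _ By; have -> : (z + minus y z = y)%C.
    by rewrite /minus /plus /opp /=; ring.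
  by [].
Qed.

Lemma is_deriveP (f : R -> C) (x : R) (l : C) :
  is_derC f x l <->
  forall eps, 0 < eps -> exists2 d, 0 < d & forall h : R, Rabs h < d ->
    Cmod (f (x + h)%R - f x - h * l)%C <= eps * Rabs h.
Proof.
have Es : forall (h : R) (l : C), @scal R_AbsRing C_R_NormedModule h l = (h * l)%C.
  by move=> h [a b]; rewrite /scal /= /prod_scal /scal /= /mult /= /Cmult /=; congr pair; ring.
split.
- move=> [_ H] eps e0.
  have [d Hd] : locally x (fun y : R => Cmod (f y - f x - (y - x)%R * l)%C <= eps * Rabs (y - x)).
    have := (H x (fun P HP => HP) (mkposreal eps e0)).
    apply: filter_imp => y; rewrite -Cmod_norm Es; exact.
  exists d; first exact: cond_pos.
  move=> h hd.
  have -> : (h = x + h - x)%R by ring.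
  have -> : (x + (x + h - x) = x + h)%R by ring.
  by apply: Hd; rewrite /ball /= /AbsRing_ball /abs /minus /plus /opp /=; rewrite Rplus_comm -Rplus_assoc Rplus_opp_l Rplus_0_l.
- move=> H; split.
    exact: is_linear_scal_l.
  move=> y Hy eps.
  have -> : y = x by symmetry; apply: (@is_filter_lim_locally_unique R_AbsRing R_NormedModule).
  have [d d0 Hd] := H eps (cond_pos eps).
  exists (mkposreal d d0) => u.
  rewrite /ball /= /AbsRing_ball /abs /minus /plus /opp /= => Bu.
  have := Hd _ Bu; have -> : (x + (u + - x) = u)%R by ring.
  by rewrite -Cmod_norm Es.
Qed.

Lemma C_is_derive_AbsRing (f : C -> C) (z l : C) :
  C_is_derive f z l <->
  @is_derive C_AbsRing (AbsRing_NormedModule C_AbsRing) f z l.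
Proof.
split=> -[_ H]; split.
- exact: (@is_linear_scal_l C_AbsRing (AbsRing_NormedModule C_AbsRing)).
- exact: H.
- exact: (@is_linear_scal_l C_AbsRing C_NormedModule).
- exact: H.
Qed.

Lemma C_is_derive_mult (f g : C -> C) (z a b : C) :
  C_is_derive f z a -> C_is_derive g z b ->
  C_is_derive (fun x => f x * g x)%C z (a * g z + f z * b)%C.
Proof.
move=> /C_is_derive_AbsRing fa /C_is_derive_AbsRing gb.
by apply/C_is_derive_AbsRing; apply: (is_derive_mult f g z a b fa gb Cmult_comm).
Qed.

Lemma C_is_derive_const (c z : C) : C_is_derive (fun _ => c) z 0.
Proof. exact: (@is_derive_const C_AbsRing C_NormedModule c z). Qed.

Lemma C_is_derive_comp (f g : C -> C) (z a b : C) :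
  C_is_derive f (g z) a -> C_is_derive g z b ->
  C_is_derive (fun x => f (g x)) z (b * a)%C.
Proof.
move=> fa /C_is_derive_AbsRing gb.
exact: (is_derive_comp f g z a b fa gb).
Qed.

Lemma C_is_derive_scal (c : C) (f : C -> C) (z l : C) :
  C_is_derive f z l -> C_is_derive (fun x => c * f x)%C z (c * l)%C.
Proof.
move=> H; have := C_is_derive_mult (C_is_derive_const c z) H.
by have -> : (0 * f z + c * l = c * l)%C by ring.
Qed.

Lemma C_is_derive_plus (f g : C -> C) (z a b : C) :
  C_is_derive f z a -> C_is_derive g z b ->
  C_is_derive (fun x => f x + g x)%C z (a + b)%C.
Proof. exact: (@is_derive_plus C_AbsRing C_NormedModule). Qed.

Lemma C_is_derive_opp (f : C -> C) (z a : C) :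
  C_is_derive f z a -> C_is_derive (fun x => - f x)%C z (- a)%C.
Proof. exact: (@is_derive_opp C_AbsRing C_NormedModule). Qed.

Lemma C_is_derive_translate (f : C -> C) (c z l : C) :
  C_is_derive f (z + c)%C l -> C_is_derive (fun x => f (x + c)%C) z l.
Proof.
move=> /C_is_deriveP H; apply/C_is_deriveP => e e0.
have [d d0 Hd] := H e e0; exists d => // h hd; have := Hd h hd.
by have -> : (z + c + h = z + h + c)%C by ring.
Qed.

(** Chain rule for a holomorphic function along a real path: the two derivatives are
over different scalar fields, so the error terms are compared by hand. *)
Lemma is_derive_C_comp (f : C -> C) (g : R -> C) (x : R) (a b : C) :
  C_is_derive f (g x) a -> is_derC g x b ->
  is_derC (fun t => f (g t)) x (b * a)%C.
Proof.
move=> /C_is_deriveP fa /is_deriveP gb; apply/is_deriveP => e e0.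
have a0 := Cmod_ge_0 a; have b0 := Cmod_ge_0 b.
(* The increment of g is at most k |h|; each of the two error terms gets e / 2. *)
pose k := Cmod b + 1.
have [d d0 Hd] := fa (e / 2 / k) ltac:(apply: Rdiv_lt_0_compat; rewrite /k; lra).
pose c := Rmin 1 (e / 2 / (Cmod a + 1)).
have c0 : 0 < c by apply: Rmin_pos; [lra | apply: Rdiv_lt_0_compat; lra].
have [d' d'0 Hd'] := gb c c0.
exists (Rmin d' (d / k)).
  by apply: Rmin_pos => //; apply: Rdiv_lt_0_compat; rewrite /k; lra.
move=> h hd.
have h0 := Rabs_pos h.
have h1 := Rlt_le_trans _ _ _ hd (Rmin_l _ _).
have h2 := Rlt_le_trans _ _ _ hd (Rmin_r _ _).
have {Hd'} H1 := Hd' h h1.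
set D := (g (x + h)%R - g x)%C.
have HD : Cmod D <= k * Rabs h.
  have -> : D = ((g (x + h)%R - g x - h * b) + h * b)%C by rewrite /D; ring.
  apply: Rle_trans (Cmod_triangle _ _) _; rewrite Cmod_mult Cmod_R.
  have := Rmin_l 1 (e / 2 / (Cmod a + 1)); rewrite -/c /k; nra.
have HDd : Cmod D < d.
  apply: Rle_lt_trans HD _.
  have -> : d = k * (d / k) by field; rewrite /k; lra.
  by apply: Rmult_lt_compat_l => //; rewrite /k; lra.
have := Hd D HDd; have -> : (g x + D)%C = g (x + h)%R by rewrite /D; ring.
move=> H2.
have -> : (f (g (x + h)%R) - f (g x) - h * (b * a))%C =
          (f (g (x + h)%R) - f (g x) - D * a + (g (x + h)%R - g x - h * b) * a)%C.
  by rewrite /D; ring.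
apply: Rle_trans (Cmod_triangle _ _) _; rewrite Cmod_mult.
have E1 : e / 2 / k * Cmod D <= e / 2 * Rabs h.
  have -> : e / 2 * Rabs h = e / 2 / k * (k * Rabs h) by field; rewrite /k; lra.
  apply: Rmult_le_compat_l => //; apply: Rlt_le; apply: Rdiv_lt_0_compat; rewrite /k; lra.
have E2 : c * Cmod a <= e / 2.
  apply: Rle_trans (Rmult_le_compat_r _ _ _ a0 (Rmin_r _ _)) _.
  have {2}-> : e / 2 = e / 2 / (Cmod a + 1) * (Cmod a + 1) by field; lra.
  apply: Rmult_le_compat_l; last by lra.
  apply: Rlt_le; apply: Rdiv_lt_0_compat; lra.
nra.
Qed.

Lemma is_derive_components (f : R -> C) (x : R) (l : C) :
  is_derC f x l <->
  is_derive (fun t => Re (f t)) x (Re l) /\ is_derive (fun t => Im (f t)) x (Im l).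
Proof.
split.
- move=> H; split.
  + exact: (@filterdiff_comp R_AbsRing R_NormedModule C_R_NormedModule R_NormedModule
      (locally x) _ f fst _ fst H (filterdiff_linear _ is_linear_fst)).
  + exact: (@filterdiff_comp R_AbsRing R_NormedModule C_R_NormedModule R_NormedModule
      (locally x) _ f snd _ snd H (filterdiff_linear _ is_linear_snd)).
- move=> [/(is_derive_scal_l (V := C_R_NormedModule) _ _ _ (RtoC 1)) H1
          /(is_derive_scal_l (V := C_R_NormedModule) _ _ _ Ci) H2].
  have H := is_derive_plus _ _ _ _ _ H1 H2.
  have E (z : C) : @plus C_R_NormedModule (scal (Re z) (RtoC 1)) (scal (Im z) Ci) = z.
    case: z => a b; rewrite /scal /plus /= /prod_scal /prod_plus /scal /plus /= /mult /=.
    by congr pair; ring.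
  rewrite E in H.
  by apply: is_derive_ext H => t; rewrite E.
Qed.

Lemma is_derive_Cmult (f g : R -> C) (x : R) (a b : C) :
  is_derC f x a ->
  is_derC g x b ->
  is_derC (fun t => f t * g t)%C x (a * g x + f x * b)%C.
Proof.
move=> /is_derive_components [f1 f2] /is_derive_components [g1 g2].
have M (u v : R -> R) du dv : is_derive u x du -> is_derive v x dv ->
    is_derive (fun t => u t * v t) x (du * v x + u x * dv).
  by move=> Hu Hv; apply: (is_derive_mult u v x du dv Hu Hv Rmult_comm).
apply/is_derive_components; split => /=.
- apply: (is_derive_ext (fun t => Re (f t) * Re (g t) - Im (f t) * Im (g t))) => //.
  have -> : (Re a * Re (g x) - Im a * Im (g x) + (Re (f x) * Re b - Im (f x) * Im b))
    = ((Re a * Re (g x) + Re (f x) * Re b) - (Im a * Im (g x) + Im (f x) * Im b)) by ring.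
  by apply: (@is_derive_minus R_AbsRing R_NormedModule); apply: M.
- apply: (is_derive_ext (fun t => Re (f t) * Im (g t) + Im (f t) * Re (g t))) => //.
  have -> : (Re a * Im (g x) + Im a * Re (g x) + (Re (f x) * Im b + Im (f x) * Re b))
    = ((Re a * Im (g x) + Re (f x) * Im b) + (Im a * Re (g x) + Im (f x) * Re b)) by ring.
  by apply: (@is_derive_plus R_AbsRing R_NormedModule); apply: M.
Qed.

(** * The complex exponential *)

Lemma Cexp_0 : Cexp 0 = 1.
Proof. by rewrite /Cexp /= exp_0 cos_0 sin_0 Rmult_0_r Rmult_1_r. Qed.

Lemma Cexp_add x y : Cexp (x + y) = (Cexp x * Cexp y)%C.
Proof.
rewrite /Cexp /Cmult /= -/(Re x) -/(Re y) -/(Im x) -/(Im y).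
by rewrite exp_plus cos_plus sin_plus; congr pair; ring.
Qed.

Lemma Cexp_opp x : (Cexp x * Cexp (- x) = 1)%C.
Proof. by rewrite -Cexp_add Cplus_opp_r Cexp_0. Qed.

Lemma Cexp_neq0 x : Cexp x <> 0.
Proof.
move=> E; have := Cexp_opp x; rewrite E Cmult_0_l => /(f_equal fst) /=; lra.
Qed.

Lemma Cmod_Cexp x : Cmod (Cexp x) = exp (Re x).
Proof.
rewrite /Cmod /=.
have -> : exp (Re x) * cos (Im x) * (exp (Re x) * cos (Im x) * 1) +
   exp (Re x) * sin (Im x) * (exp (Re x) * sin (Im x) * 1)
   = Rsqr (exp (Re x)) * (Rsqr (sin (Im x)) + Rsqr (cos (Im x))).
  by rewrite /Rsqr; ring.
by rewrite sin2_cos2 Rmult_1_r sqrt_Rsqr //; apply: Rlt_le; apply: exp_pos.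
Qed.

Lemma Cexp_real (x : R) : Cexp x = exp x.
Proof. by rewrite /Cexp /= cos_0 sin_0 Rmult_0_r Rmult_1_r. Qed.

Lemma is_derive_Cexp_line (x : C) (t : R) :
  is_derC (fun t : R => Cexp (t * x)) t (x * Cexp (t * x))%C.
Proof.
have E (u : R) : Re (u * x) = u * Re x by rewrite /Cmult /Re /=; ring.
have F (u : R) : Im (u * x) = u * Im x by rewrite /Cmult /Im /=; ring.
rewrite /Cexp E F; apply/is_derive_components; split.
  apply: (is_derive_ext (fun u => exp (u * Re x) * cos (u * Im x))).
    by move=> u; rewrite E F.
  by auto_derive => //; rewrite /Cmult /Re /Im /=; ring.
apply: (is_derive_ext (fun u => exp (u * Re x) * sin (u * Im x))).
  by move=> u; rewrite E F.
by auto_derive => //; rewrite /Cmult /Re /Im /=; ring.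
Qed.

Lemma mean_value_C (f df : R -> C) (g dg : R -> R) (a b : R) : a <= b ->
  (forall t, a <= t <= b -> is_derC f t (df t)) ->
  (forall t, a <= t <= b -> contC df t) ->
  (forall t, a <= t <= b -> is_derive g t (dg t)) ->
  (forall t, a <= t <= b -> continuous dg t) ->
  (forall t, a <= t <= b -> Cmod (df t) <= dg t) ->
  Cmod (f b - f a) <= g b - g a.
Proof.
move=> ab df1 df2 dg1 dg2 le.
have If : is_intC df a b (f b - f a)%C.
  by apply: (@is_RInt_derive C_R_CompleteNormedModule) => x;
    rewrite Rmin_left // Rmax_right //; [exact: df1 | exact: df2].
have Ig : is_RInt dg a b (g b - g a).
  by apply: (@is_RInt_derive R_CompleteNormedModule) => x;
    rewrite Rmin_left // Rmax_right //; [exact: dg1 | exact: dg2].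
have := norm_RInt_le df dg a b _ _ ab _ If Ig.
rewrite -Cmod_norm; apply=> x Hx; rewrite -Cmod_norm; exact: le.
Qed.

Definition exp_term (x : C) (k : nat) : C := (x ^ k * RtoC (/ INR (Factorial.fact k)))%C.

Lemma is_derive_Cpow_line (x : C) (t : R) k :
  is_derC (fun t : R => exp_term (t * x) k.+1) t
    (x * exp_term (t * x) k)%C.
Proof.
have E (u : R) : exp_term (u * x) k.+1 = (RtoC (u ^ k.+1) * exp_term x k.+1)%C.
  by rewrite /exp_term Cpow_mult_l -RtoC_pow; ring.
apply: (is_derive_ext (fun u : R => scal (u ^ k.+1) (exp_term x k.+1 : C_R_NormedModule))).
  move=> u; rewrite E /exp_term; case: (x ^ k.+1 * _)%C => a b.
  by rewrite /scal /= /prod_scal /scal /= /mult /= /Cmult /=; congr pair; ring.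
have -> : (x * exp_term (t * x) k)%C = scal (INR k.+1 * t ^ k) (exp_term x k.+1 : C_R_NormedModule).
  have -> : (x * exp_term (t * x) k = RtoC (INR k.+1 * t ^ k) * exp_term x k.+1)%C.
    rewrite /exp_term Cpow_mult_l Cpow_S -RtoC_pow.
    have -> : RtoC (/ INR (Factorial.fact k)) = (RtoC (INR k.+1) * RtoC (/ INR (Factorial.fact k.+1)))%C.
      rewrite -RtoC_mult; congr RtoC.
      have := INR_fact_neq_0 k; have := not_0_INR k.+1 ltac:(lia) => n1 n2.
      rewrite -[Factorial.fact k.+1]/(Nat.mul k.+1 (Factorial.fact k)) mult_INR; field; lra.
    by rewrite RtoC_mult; ring.
  case: (exp_term x k.+1) => a b.
  by rewrite /scal /= /prod_scal /scal /= /mult /= /Cmult /=; congr pair; ring.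
apply: (@is_derive_scal_l R_AbsRing C_R_NormedModule).
by auto_derive => //; rewrite Rmult_1_l.
Qed.

(** Along a line t x, the remainder of order n + 1 is an antiderivative of x times the
one of order n, which turns estimates of remainders into inductions on the order. *)
Definition exp_rem (x : C) (n : nat) : C :=
  (Cexp x - \big[Cplus/RtoC 0]_(k < n) exp_term x k)%C.

Lemma exp_rem0 n : exp_rem 0 n.+1 = 0.
Proof.
rewrite /exp_rem big_ord_recl big1 => [|i _].
  by rewrite Cexp_0 /exp_term /= Rinv_1; ring.
by rewrite /exp_term lift0 Cpow_S; ring.
Qed.

Lemma is_derive_exp_rem (x : C) (t : R) n :
  is_derC (fun t : R => exp_rem (t * x) n.+1) t
    (x * exp_rem (t * x) n)%C.
Proof.
elim: n => [|n IH].
  apply: (is_derive_ext (fun u : R => @minus C_R_NormedModule (Cexp (u * x)) (RtoC 1))).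
    move=> u; rewrite /exp_rem big_ord_recl big_ord0 /exp_term /= Rinv_1.
    by rewrite -[LHS]/(Cexp (u * x) - 1)%C; ring.
  have -> : (x * exp_rem (t * x) 0)%C = @minus C_R_NormedModule (x * Cexp (t * x))%C (RtoC 0).
    by rewrite -[RHS]/(x * Cexp (t * x) - 0)%C /exp_rem big_ord0; ring.
  apply: (@is_derive_minus R_AbsRing C_R_NormedModule); first exact: is_derive_Cexp_line.
  exact: (@is_derive_const R_AbsRing C_R_NormedModule).
apply: (is_derive_ext (fun u : R => @minus C_R_NormedModule (exp_rem (u * x) n.+1) (exp_term (u * x) n.+1))).
  by move=> u; rewrite -[LHS]/(exp_rem (u * x) n.+1 - exp_term (u * x) n.+1)%C
     /exp_rem [in RHS]big_ord_recr /=; ring.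
have -> : (x * exp_rem (t * x) n.+1)%C
  = @minus C_R_NormedModule (x * exp_rem (t * x) n)%C (x * exp_term (t * x) n)%C.
  by rewrite -[RHS]/(x * exp_rem (t * x) n - x * exp_term (t * x) n)%C
     /exp_rem [in LHS]big_ord_recr /=; ring.
apply: (@is_derive_minus R_AbsRing C_R_NormedModule); first exact: IH.
exact: is_derive_Cpow_line.
Qed.

(** The factor q ^ n is what makes the expansion of u^-w in powers of w - c converge
uniformly after multiplication by u^(-c): with x = - (w - c) ln u and
y = (c - 2) ln u the bound is q^n u^(c-2). Induction on n along the line t x, since
integrating the derivative q y q^n e^(t y) of the bound gains exactly one q. *)
Lemma Cmod_exp_rem_le_line (x : C) (q y : R) n (t : R) :
  0 <= q <= 1 -> 0 <= y -> Cmod x <= q * y -> 0 <= t ->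
  Cmod (exp_rem (t * x) n) <= q ^ n * exp (t * y).
Proof.
move=> q01 y0 xy; elim: n t => [|n IH] t t0.
  rewrite /exp_rem big_ord0 /=.
  have -> : (Cexp (t * x) - 0 = Cexp (t * x))%C by ring.
  rewrite Cmod_Cexp Rmult_1_l.
  have : t * Re x <= t * y.
    apply: Rmult_le_compat_l => //.
    have := re_le_Cmod x; have := Rle_abs (Re x); have := Cmod_ge_0 x; nra.
  have -> : Re (t * x) = t * Re x by rewrite /Re /Cmult /=; ring.
  case=> [/exp_increasing|->]; lra.
have -> : exp_rem (t * x) n.+1 = (exp_rem (t * x) n.+1 - exp_rem (0%R * x) n.+1)%C.
  have -> : (0%R * x = 0)%C by ring.
  by rewrite exp_rem0; ring.
pose g u := q ^ n.+1 * exp (u * y).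
apply: Rle_trans (_ : g t - g 0 <= _); last first.
  rewrite /g; have := exp_pos (0 * y); have := pow_le q n.+1 (proj1 q01); nra.
apply: (mean_value_C (f := fun t : R => exp_rem (t * x) n.+1)
  (df := fun t => (x * exp_rem (t * x) n)%C) (dg := fun t => q * y * (q ^ n * exp (t * y)))) => //.
- by move=> u _; apply: is_derive_exp_rem.
- move=> u _.
  apply: (@continuous_ext R_UniformSpace C_UniformSpace
    (fun u => @plus C_R_NormedModule (x * exp_rem (u * x) n.+1) (x * exp_term (u * x) n))%C).
    by move=> v; rewrite -[LHS]/(x * exp_rem (v * x) n.+1 + x * exp_term (v * x) n)%C
     /exp_rem big_ord_recr /=; ring.
  have Cm (f : R -> C) l : is_derC f u l ->
      contC (fun u => x * f u)%C u.
    move=> H.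
    apply: (@ex_derive_continuous R_AbsRing C_R_NormedModule (fun u => x * f u)%C).
    exists (x * f u * 0 + l * x)%C; apply: (is_derive_ext (fun v => (x * f v)%C)) => //.
    have -> : (x * f u * 0 + l * x = 0 * f u + x * l)%C by ring.
    apply: (is_derive_Cmult (f := fun=> x)) => //.
    exact: (@is_derive_const R_AbsRing C_R_NormedModule).
  apply: (@continuous_plus R_UniformSpace R_AbsRing C_R_NormedModule).
    exact: (Cm _ _ (is_derive_exp_rem x u n)).
  case: n {IH g} => [|n].
    apply: (@continuous_ext R_UniformSpace C_UniformSpace (fun=> x * exp_term 0 0)%C).
      by move=> v; rewrite /exp_term.
    exact: continuous_const.
  exact: (Cm _ _ (is_derive_Cpow_line x u n)).
- by move=> u _; rewrite /g /=; auto_derive => //; ring.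
- move=> u _; apply: (@ex_derive_continuous R_AbsRing R_NormedModule); auto_derive => //.
- move=> u u0; rewrite Cmod_mult; apply: Rmult_le_compat => //; try exact: Cmod_ge_0.
  by apply: IH; lra.
Qed.

Lemma Cmod_exp_rem_le (x : C) (q y : R) n : 0 <= q <= 1 -> 0 <= y -> Cmod x <= q * y ->
  Cmod (exp_rem x n) <= q ^ n * exp y.
Proof.
move=> q01 y0 xy; have := Cmod_exp_rem_le_line n q01 y0 xy Rle_0_1.
by rewrite Rmult_1_l Cmult_1_l.
Qed.

Lemma C_is_derive_Cexp z : C_is_derive Cexp z (Cexp z).
Proof.
apply/C_is_deriveP => e e0.
pose k := Cmod (Cexp z) * exp 1 + 1.
have k0 : 0 < k by rewrite /k; have := exp_pos 1; have := Cmod_ge_0 (Cexp z); nra.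
exists (Rmin 1 (e / k)); first by apply: Rmin_pos; [lra | apply: Rdiv_lt_0_compat].
move=> h hd.
have h1 := Rlt_le_trans _ _ _ hd (Rmin_l _ _).
have h2 := Rlt_le_trans _ _ _ hd (Rmin_r _ _).
have h0 := Cmod_ge_0 h.
have -> : (Cexp (z + h) - Cexp z - h * Cexp z = Cexp z * exp_rem h 2)%C.
  rewrite Cexp_add /exp_rem !big_ord_recr big_ord0 /= /exp_term /= Rinv_1; ring.
rewrite Cmod_mult.
have := @Cmod_exp_rem_le h (Cmod h) 1 2 ltac:(lra) ltac:(lra) ltac:(lra).
move=> /(Rmult_le_compat_l _ _ _ (Cmod_ge_0 (Cexp z))) H; apply: Rle_trans H _.
have -> : Cmod (Cexp z) * (Cmod h ^ 2 * exp 1) = (k - 1) * Cmod h * Cmod h by rewrite /k; ring.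
apply: Rmult_le_compat_r => //.
have : Cmod h * k <= e by apply/Rlt_le/(Rmult_lt_reg_r (/ k));
  [exact: Rinv_0_lt_compat | rewrite Rmult_assoc Rinv_r ?Rmult_1_r //; lra].
nra.
Qed.

Lemma C_is_derive_inv (z : C) : z <> 0 -> C_is_derive Cinv z (- / (z * z))%C.
Proof.
move=> z0; apply/C_is_deriveP => e e0.
have m0 : 0 < Cmod z by apply: (proj1 (Cmod_gt_0 _)).
(* Near z, |z + h| >= |z| / 2, so the remainder h^2 / (z^2 (z + h)) is at most k |h|^2. *)
pose k := 2 / (Cmod z * Cmod z * Cmod z).
have k0 : 0 < k by apply: Rdiv_lt_0_compat; [lra | by repeat apply: Rmult_lt_0_compat].
exists (Rmin (Cmod z / 2) (e / k)).
  by apply: Rmin_pos; [lra | apply: Rdiv_lt_0_compat].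
move=> h hd.
have h1 := Rlt_le_trans _ _ _ hd (Rmin_l _ _).
have h2 := Rlt_le_trans _ _ _ hd (Rmin_r _ _).
have h0 := Cmod_ge_0 h.
have m1 : Cmod z / 2 <= Cmod (z + h).
  have := Cmod_triangle_sub (z + h) h; have -> : (z + h - h = z)%C by ring.
  lra.
have n0 : (z + h <> 0)%C by apply: (proj2 (Cmod_gt_0 _)); lra.
have -> : (/ (z + h) - / z - h * - / (z * z) = h * h / (z * z * (z + h)))%C.
  by field; split.
rewrite Cmod_div ?Cmod_mult; last first.
  by apply: Cmult_neq_0 => //; apply: Cmult_neq_0.
have H : / (Cmod z * Cmod z * Cmod (z + h)) <= k.
  have -> : k = / (Cmod z * Cmod z * (Cmod z / 2)) by rewrite /k; field; lra.
  apply: Rinv_le_contravar; first by repeat apply: Rmult_lt_0_compat => //; lra.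
  by apply: Rmult_le_compat_l => //; nra.
rewrite /Rdiv.
have : Cmod h * k <= e.
  by apply/Rlt_le/(Rmult_lt_reg_r (/ k));
    [exact: Rinv_0_lt_compat | rewrite Rmult_assoc Rinv_r ?Rmult_1_r //; lra].
have : Cmod h * Cmod h * / (Cmod z * Cmod z * Cmod (z + h)) <= Cmod h * Cmod h * k.
  by apply: Rmult_le_compat_l => //; nra.
nra.
Qed.

(** * Limits and series of complex numbers *)

(** Convergence through the modulus, which reduces all limit rules to squeezing real
sequences. *)
Definition Clim (x : nat -> C) (l : C) : Prop :=
  is_lim_seq (fun n => Cmod (x n - l)) 0.

Definition Csum (f : nat -> C) (n : nat) : C := \big[Cplus/RtoC 0]_(k < n) f k.

Lemma CsumS f n : Csum f n.+1 = (Csum f n + f n)%C.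
Proof. by rewrite /Csum big_ord_recr. Qed.

Lemma Csum0 f : Csum f 0 = 0.
Proof. by rewrite /Csum big_ord0. Qed.

Lemma Csum_recl f n : Csum f n.+1 = (f O + Csum (fun k => f k.+1) n)%C.
Proof. by rewrite /Csum big_ord_recl; congr (_ + _)%C; apply: eq_bigr => i _; rewrite lift0. Qed.

Lemma Csum_ext f g n : f =1 g -> Csum f n = Csum g n.
Proof. by move=> e; apply: eq_bigr => i _; rewrite e. Qed.

Lemma Csum_plus f g n : Csum (fun k => f k + g k)%C n = (Csum f n + Csum g n)%C.
Proof. exact: big_split. Qed.

Lemma Csum_scal c f n : Csum (fun k => c * f k)%C n = (c * Csum f n)%C.
Proof. by rewrite /Csum big_distrr. Qed.

Lemma Clim_le x l e : (forall n, Cmod (x n - l)%C <= e n) -> is_lim_seq e 0 -> Clim x l.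
Proof.
move=> H He; apply: (is_lim_seq_le_le (fun=> 0) _ e) => //; last exact: is_lim_seq_const.
by move=> n; split; [exact: Cmod_ge_0 | exact: H].
Qed.

Lemma Clim_ext x y l : (forall n, x n = y n) -> Clim x l -> Clim y l.
Proof. by move=> e; apply: is_lim_seq_ext => n; rewrite e. Qed.

Lemma Clim_const c : Clim (fun=> c) c.
Proof.
apply: (@Clim_le _ _ (fun=> 0)); last exact: is_lim_seq_const.
move=> n; have -> : (c - c = 0)%C by ring.
by rewrite Cmod_0; lra.
Qed.

Lemma Clim_plus x y a b : Clim x a -> Clim y b -> Clim (fun n => x n + y n)%C (a + b)%C.
Proof.
move=> Hx Hy; apply: (@Clim_le _ _ (fun n => Cmod (x n - a) + Cmod (y n - b))).
  move=> n; have -> : (x n + y n - (a + b) = (x n - a) + (y n - b))%C by ring.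
  exact: Cmod_triangle.
have := is_lim_seq_plus' _ _ _ _ Hx Hy; by rewrite Rplus_0_l.
Qed.

Lemma Clim_scal c x a : Clim x a -> Clim (fun n => c * x n)%C (c * a)%C.
Proof.
move=> Hx; apply: (@Clim_le _ _ (fun n => Cmod c * Cmod (x n - a))).
  move=> n; have -> : (c * x n - c * a = c * (x n - a))%C by ring.
  by rewrite Cmod_mult; lra.
have := is_lim_seq_scal_l _ (Cmod c) _ Hx; by rewrite /= Rmult_0_r.
Qed.

Lemma Clim_minus x y a b : Clim x a -> Clim y b -> Clim (fun n => x n - y n)%C (a - b)%C.
Proof.
move=> Hx Hy; have -> : (a - b = a + (- (1)) * b)%C by ring.
apply: Clim_ext (Clim_plus Hx (Clim_scal (- (1)) Hy)) => n; ring.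
Qed.

Lemma Clim_sum (N : nat) (x : nat -> nat -> C) (l : nat -> C) :
  (forall k, Clim (fun n => x k n) (l k)) ->
  Clim (fun n => Csum (fun k => x k n) N) (Csum l N).
Proof.
move=> H; elim: N => [|N IH].
  by rewrite Csum0; apply: Clim_ext (Clim_const _) => n; rewrite Csum0.
by rewrite CsumS; apply: Clim_ext (Clim_plus IH (H N)) => n; rewrite CsumS.
Qed.

Lemma Clim_Cmod_le x l M : Clim x l -> (forall n, Cmod (x n) <= M) -> Cmod l <= M.
Proof.
move=> Hx H.
suff : Rbar_le (Cmod l - M) 0 by rewrite /=; lra.
apply: is_lim_seq_le (is_lim_seq_const _) Hx => n.
have := Cmod_triangle_sub (x n) (x n - l)%C.
have -> : (x n - (x n - l) = l)%C by ring.
have := H n; lra.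
Qed.

Lemma Clim_unique x a b : Clim x a -> Clim x b -> a = b.
Proof.
move=> Ha Hb.
have H := Clim_minus Ha Hb.
have /Cmod_eq_0 E : Cmod (a - b) = 0.
  apply: Rle_antisym (Cmod_ge_0 _); apply: Clim_Cmod_le H _ => n.
  have -> : (x n - x n = 0)%C by ring.
  by rewrite Cmod_0; lra.
have -> : a = (a - b + b)%C by ring.
by rewrite E; ring.
Qed.

Lemma Clim_shift x l : Clim x l -> Clim (fun n => x n.+1) l.
Proof. by move=> H; exact: (proj1 (is_lim_seq_incr_1 (fun n => Cmod (x n - l)) 0) H). Qed.

Lemma Clim_unshift x l : Clim (fun n => x n.+1) l -> Clim x l.
Proof. by move=> H; exact: (proj2 (is_lim_seq_incr_1 (fun n => Cmod (x n - l)) 0) H). Qed.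

Lemma sum_n_Csum (f : nat -> C) n : @sum_n C_R_NormedModule f n = Csum f n.+1.
Proof.
elim: n => [|n IH]; first by rewrite sum_O CsumS Csum0 Cplus_0_l.
by rewrite sum_Sn IH [in RHS]CsumS.
Qed.

Lemma Clim_filterlim x (l : C) :
  filterlim x eventually (@locally C_UniformSpace l) -> Clim x l.
Proof.
move=> H P [e He].
have s2 : 0 < sqrt 2 by apply: sqrt_lt_R0; lra.
have H' := H _ (locally_ball (l : C_UniformSpace) (mkposreal _ (Rdiv_lt_0_compat _ _ (cond_pos e) s2))).
case: H' => n0 H0; exists n0 => n /H0 /C_NormedModule_mixin_compat2 /= Hn.
apply: He; rewrite /ball /= /AbsRing_ball /abs /minus /plus /opp /=.
rewrite Ropp_0 Rplus_0_r Rabs_pos_eq; last exact: Cmod_ge_0.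
apply: Rlt_le_trans Hn _; right; field; lra.
Qed.

Lemma Clim_is_series (f : nat -> C) (l : C) :
  @is_series C_AbsRing C_NormedModule f l -> Clim (Csum f) l.
Proof.
move=> H.
have /Clim_filterlim H' : filterlim (@sum_n C_R_NormedModule f) eventually (@locally C_UniformSpace l).
  exact: H.
apply: (proj2 (is_lim_seq_incr_1 (fun n => Cmod (Csum f n - l)) 0)).
by apply: is_lim_seq_ext H' => n; rewrite sum_n_Csum.
Qed.

Lemma Clim_abs_series (f : nat -> C) (b : nat -> R) :
  (forall n, Cmod (f n) <= b n) -> ex_series b -> exists l, Clim (Csum f) l.
Proof.
move=> H Hb.
have [|l Hl] := @ex_series_le C_AbsRing C_CompleteNormedModule f b _ Hb.
  by move=> n; exact: H.
by exists l; apply: Clim_is_series.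
Qed.

Lemma Cmod_Csum_le (f : nat -> C) (b : nat -> R) M n :
  (forall n, Cmod (f n) <= b n) -> (forall n, \big[Rplus/0]_(k < n) b k <= M) ->
  Cmod (Csum f n) <= M.
Proof.
move=> H Hb; apply: Rle_trans (Cmod_sum _) _; apply: Rle_trans (Hb n).
apply: (big_ind2 (fun x y => x <= y)); [lra | move=> *; lra | by move=> i _; exact: H].
Qed.

Lemma bigR_geom_half n (c : R) : 0 <= c -> \big[Rplus/0]_(k < n) (c * (1/2) ^ k) <= 2 * c.
Proof.
move=> c0.
suff : \big[Rplus/0]_(k < n) (c * (1/2) ^ k) = 2 * c - 2 * c * (1/2) ^ n.
  move=> ->; have := pow_le (1/2) n ltac:(lra); nra.
elim: n => [|n IH]; first by rewrite big_ord0 /=; ring.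
rewrite big_ord_recr IH /=; field.
Qed.

(** * Entire power series *)

(** Coefficients of a power series with infinite radius of convergence. *)
Definition entire_coefs (a : nat -> C) : Prop :=
  forall r, 0 < r -> exists K, forall k, Cmod (a k) * r ^ k <= K.

Lemma ex_series_geom_half (c : R) : ex_series (fun k => c * (1/2) ^ k).
Proof. by apply: ex_series_scal; apply: ex_series_geom; rewrite Rabs_pos_eq; lra. Qed.

(** Comparison with the series of ratio 1/2, from the bound at radius 2 r. *)
Lemma entire_coefs_half a r : entire_coefs a -> 0 < r ->
  exists2 K, 0 <= K & forall k, Cmod (a k) * r ^ k <= K * (1 / 2) ^ k.
Proof.
move=> Ha r0; have [K HK] := Ha (2 * r) ltac:(lra).
exists K => [|k].
  by have := HK O; rewrite /= Rmult_1_r; have := Cmod_ge_0 (a O); lra.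
have -> : Cmod (a k) * r ^ k = Cmod (a k) * (2 * r) ^ k * (1 / 2) ^ k.
  by rewrite Rmult_assoc -Rpow_mult_distr; do 2 f_equal; field.
by apply: Rmult_le_compat_r (HK k); apply: pow_le; lra.
Qed.

Lemma Cpow_increment_le (r : R) (z h : C) m : 1 <= r -> Cmod z <= r -> Cmod (z + h) <= r ->
  Cmod ((z + h) ^ m - z ^ m)%C <= Cmod h * (2 * r) ^ m.
Proof.
move=> r1 zr zhr; have h0 := Cmod_ge_0 h.
elim: m => [|m IH].
  have -> : ((z + h) ^ 0 - z ^ 0 = 0)%C by rewrite /=; ring.
  by rewrite Cmod_0 /=; lra.
have -> : ((z + h) ^ m.+1 - z ^ m.+1 = z * ((z + h) ^ m - z ^ m) + h * (z + h) ^ m)%C.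
  by rewrite !Cpow_S; ring.
apply: Rle_trans (Cmod_triangle _ _) _; rewrite !Cmod_mult Cmod_pow.
have P : Cmod (z + h) ^ m <= (2 * r) ^ m.
  by apply: pow_incr; have := Cmod_ge_0 (z + h); lra.
have P0 : 0 <= (2 * r) ^ m by apply: pow_le; lra.
have := Cmod_ge_0 z; have := Cmod_ge_0 ((z + h) ^ m - z ^ m)%C.
have : Cmod z * Cmod ((z + h) ^ m - z ^ m) <= r * (Cmod h * (2 * r) ^ m).
  by apply: Rmult_le_compat => //; exact: Cmod_ge_0.
have : Cmod h * Cmod (z + h) ^ m <= Cmod h * (2 * r) ^ m by apply: Rmult_le_compat_l.
have : Cmod h * (2 * r) ^ m <= r * (Cmod h * (2 * r) ^ m).
  by rewrite -{1}(Rmult_1_l (_ * _)); apply: Rmult_le_compat_r => //; apply: Rmult_le_pos.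
by rewrite /=; lra.
Qed.

(** A quadratic remainder bound, crude but geometric in m, which is all that termwise
differentiation of an entire power series needs. *)
Lemma Cpow_taylor2_le (r : R) (z h : C) m : 1 <= r -> Cmod z <= r -> Cmod (z + h) <= r ->
  Cmod ((z + h) ^ m.+1 - z ^ m.+1 - INR m.+1 * h * z ^ m)%C <= Cmod h ^ 2 * (2 * r) ^ m.+1.
Proof.
move=> r1 zr zhr; have h0 := Cmod_ge_0 h.
elim: m => [|m IH].
  have -> : ((z + h) ^ 1 - z ^ 1 - INR 1 * h * z ^ 0 = 0)%C by rewrite /=; ring.
  by rewrite Cmod_0; apply: Rmult_le_pos; apply: pow_le; lra.
have -> : ((z + h) ^ m.+2 - z ^ m.+2 - INR m.+2 * h * z ^ m.+1
   = z * ((z + h) ^ m.+1 - z ^ m.+1 - INR m.+1 * h * z ^ m)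
     + h * ((z + h) ^ m.+1 - z ^ m.+1))%C.
  by rewrite (S_INR m.+1) RtoC_plus !Cpow_S; ring.
apply: Rle_trans (Cmod_triangle _ _) _; rewrite !Cmod_mult.
have H := Cpow_increment_le m.+1 r1 zr zhr.
have P0 : 0 <= Cmod h ^ 2 * (2 * r) ^ m.+1 by apply: Rmult_le_pos; apply: pow_le; lra.
have : Cmod z * Cmod ((z + h) ^ m.+1 - z ^ m.+1 - INR m.+1 * h * z ^ m)
     <= r * (Cmod h ^ 2 * (2 * r) ^ m.+1).
  by apply: Rmult_le_compat => //; exact: Cmod_ge_0.
have : Cmod h * Cmod ((z + h) ^ m.+1 - z ^ m.+1) <= Cmod h * (Cmod h * (2 * r) ^ m.+1).
  by apply: Rmult_le_compat_l.
have : Cmod h ^ 2 * (2 * r) ^ m.+1 <= r * (Cmod h ^ 2 * (2 * r) ^ m.+1).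
  by rewrite -{1}(Rmult_1_l (_ * _)); apply: Rmult_le_compat_r.
rewrite -[(2 * r) ^ m.+2]/(2 * r * (2 * r) ^ m.+1).
have -> : Cmod h * (Cmod h * (2 * r) ^ m.+1) = Cmod h ^ 2 * (2 * r) ^ m.+1 by ring.
lra.
Qed.

Lemma is_lim_seq_geom0 (c q : R) : 0 <= q < 1 -> is_lim_seq (fun n => c * q ^ n) 0.
Proof.
move=> q01.
have := is_lim_seq_scal_l _ c _ (is_lim_seq_geom q ltac:(rewrite Rabs_pos_eq; lra)).
by rewrite /= Rmult_0_r.
Qed.

(** The primitive is sum a_k z^(k+1) / (k+1). Its difference quotient is compared with
the series term by term, and the quadratic remainders are summable. *)
Lemma power_series_primitive (a : nat -> C) : entire_coefs a ->
  exists H : C -> C, forall z l,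
    Clim (Csum (fun k => a k * z ^ k)%C) l -> C_is_derive H z l.
Proof.
move=> Ha.
pose p (z : C) k := (a k * RtoC (/ INR k.+1) * z ^ k.+1)%C.
have Hp z : exists l, Clim (Csum (p z)) l.
  have r0 : 0 < Cmod z + 1 by have := Cmod_ge_0 z; lra.
  have [K K0 HK] := entire_coefs_half Ha r0.
  apply: (@Clim_abs_series _ (fun k => (Cmod z + 1) * K * (1/2) ^ k)); last exact: ex_series_geom_half.
  move=> k; rewrite /p !Cmod_mult Cmod_pow Cmod_R.
  have i1 : 1 <= INR k.+1 by rewrite S_INR; have := pos_INR k; lra.
  have i2 : / INR k.+1 <= 1 by rewrite -Rinv_1; apply: Rinv_le_contravar; lra.
  have i3 : 0 < / INR k.+1 by apply: Rinv_0_lt_compat; lra.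
  rewrite Rabs_pos_eq; last lra.
  have P : Cmod z ^ k.+1 <= (Cmod z + 1) * (Cmod z + 1) ^ k.
    by apply: (pow_incr _ _ k.+1); have := Cmod_ge_0 z; lra.
  have P0 : 0 <= Cmod z ^ k.+1 by apply: pow_le; exact: Cmod_ge_0.
  have A0 := Cmod_ge_0 (a k).
  apply: (Rle_trans _ (Cmod (a k) * ((Cmod z + 1) * (Cmod z + 1) ^ k))).
    apply: Rmult_le_compat => //; first by nra.
    by rewrite -{2}(Rmult_1_r (Cmod (a k))); apply: Rmult_le_compat_l.
  have -> : Cmod (a k) * ((Cmod z + 1) * (Cmod z + 1) ^ k)
     = (Cmod z + 1) * (Cmod (a k) * (Cmod z + 1) ^ k) by ring.
  by rewrite Rmult_assoc; apply: Rmult_le_compat_l; [lra | exact: HK].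
pose H z := proj1_sig (constructive_indefinite_description _ (Hp z)).
have HH z : Clim (Csum (p z)) (H z) := proj2_sig (constructive_indefinite_description _ (Hp z)).
exists H => z l Hl; apply/C_is_deriveP => e e0.
pose r := Cmod z + 1.
have r1 : 1 <= r by rewrite /r; have := Cmod_ge_0 z; lra.
have [K K0 HK] := entire_coefs_half Ha (ltac:(lra) : 0 < 2 * r).
(* Summed remainders are at most 2 K (2 r) |h|^2; the 1 keeps M positive. *)
pose M := 2 * (K * (2 * r)) + 1.
have M0 : 0 < M by rewrite /M; nra.
exists (Rmin 1 (e / M)); first by apply: Rmin_pos; [lra | apply: Rdiv_lt_0_compat].
move=> h hd.
have h1 := Rlt_le_trans _ _ _ hd (Rmin_l _ _).
have h2 := Rlt_le_trans _ _ _ hd (Rmin_r _ _).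
have h0 := Cmod_ge_0 h.
have zr : Cmod z <= r by rewrite /r; lra.
have zhr : Cmod (z + h) <= r by have := Cmod_triangle z h; rewrite /r; lra.
have L := Clim_minus (Clim_minus (HH (z + h)%C) (HH z)) (Clim_scal h Hl).
apply: (Rle_trans _ (M * Cmod h * Cmod h)).
  apply: Clim_Cmod_le L _ => n.
  rewrite -Csum_scal.
  have -> : (Csum (p (z + h)) n - Csum (p z) n - Csum (fun k => h * (a k * z ^ k)) n)%C
    = Csum (fun k => a k * RtoC (/ INR k.+1) *
        ((z + h) ^ k.+1 - z ^ k.+1 - INR k.+1 * h * z ^ k))%C n.
    elim: n => [|n IH]; first by rewrite !Csum0; ring.
    rewrite !CsumS -IH /p.
    have -> : (a n * RtoC (/ INR n.+1) * ((z + h) ^ n.+1 - z ^ n.+1 - INR n.+1 * h * z ^ n)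
       = a n * RtoC (/ INR n.+1) * (z + h) ^ n.+1 - a n * RtoC (/ INR n.+1) * z ^ n.+1
         - (RtoC (/ INR n.+1) * INR n.+1) * (h * (a n * z ^ n)))%C by ring.
    have -> : (RtoC (/ INR n.+1) * INR n.+1 = 1)%C.
      by rewrite -RtoC_mult Rinv_l //; apply: not_0_INR.
    ring.
  apply: (@Cmod_Csum_le _ (fun k => K * (2 * r) * (Cmod h * Cmod h) * (1/2) ^ k)) => m.
    rewrite !Cmod_mult Cmod_R.
    have i1 : 1 <= INR m.+1 by rewrite S_INR; have := pos_INR m; lra.
    have i2 : / INR m.+1 <= 1 by rewrite -Rinv_1; apply: Rinv_le_contravar; lra.
    have i3 : 0 < / INR m.+1 by apply: Rinv_0_lt_compat; lra.
    rewrite Rabs_pos_eq; last lra.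
    have T := Cpow_taylor2_le m r1 zr zhr.
    have A0 := Cmod_ge_0 (a m).
    apply: (Rle_trans _ (Cmod (a m) * (Cmod h ^ 2 * (2 * r) ^ m.+1))).
      apply: Rmult_le_compat => //; [by nra | exact: Cmod_ge_0 |].
      by rewrite -{2}(Rmult_1_r (Cmod (a m))); apply: Rmult_le_compat_l.
    have -> : Cmod (a m) * (Cmod h ^ 2 * (2 * r) ^ m.+1)
      = (Cmod (a m) * (2 * r) ^ m) * ((2 * r) * (Cmod h * Cmod h)) by rewrite /=; ring.
    have -> : K * (2 * r) * (Cmod h * Cmod h) * (1 / 2) ^ m
      = (K * (1 / 2) ^ m) * ((2 * r) * (Cmod h * Cmod h)) by ring.
    by apply: Rmult_le_compat_r (HK m); nra.
  apply: Rle_trans (bigR_geom_half m _) _; first by repeat apply: Rmult_le_pos => //; lra.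
  rewrite /M; have := Rmult_le_pos _ _ h0 h0; lra.
have : Cmod h * M <= e.
  by apply/Rlt_le/(Rmult_lt_reg_r (/ M));
    [exact: Rinv_0_lt_compat | rewrite Rmult_assoc Rinv_r ?Rmult_1_r //; lra].
nra.
Qed.

(** * Integrals of complex functions on an interval *)

Definition intC (f : R -> C) (a b : R) : C := @RInt C_R_CompleteNormedModule f a b.

Lemma contC_AbsRing (f : R -> C) x :
  contC f x <-> @continuous R_UniformSpace (AbsRing_UniformSpace C_AbsRing) f x.
Proof.
by split=> H P HP; apply: H; [apply: (proj2 (locally_C _ _)) | apply: (proj1 (locally_C _ _))].
Qed.

Lemma contC_mult (f g : R -> C) x : contC f x -> contC g x -> contC (fun t => f t * g t)%C x.
Proof.
move=> /contC_AbsRing Hf /contC_AbsRing Hg; apply/contC_AbsRing.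
exact: (@continuous_mult R_UniformSpace C_AbsRing f g x Hf Hg).
Qed.

Lemma contC_plus (f g : R -> C) x : contC f x -> contC g x -> contC (fun t => f t + g t)%C x.
Proof. exact: (@continuous_plus R_UniformSpace R_AbsRing C_R_NormedModule f g x). Qed.

Lemma contC_const c x : contC (fun=> c) x.
Proof. exact: continuous_const. Qed.

Lemma contC_minus (f g : R -> C) x : contC f x -> contC g x -> contC (fun t => f t - g t)%C x.
Proof. exact: (@continuous_minus R_UniformSpace R_AbsRing C_R_NormedModule f g x). Qed.

Lemma contC_sum N (f : nat -> R -> C) x : (forall k, contC (f k) x) ->
  contC (fun t => Csum (fun k => f k t) N) x.
Proof.
move=> H; elim: N => [|N IH].
  by apply: (continuous_ext (fun=> RtoC 0)) => [t|]; [rewrite Csum0 | exact: contC_const].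
apply: (continuous_ext (fun t => Csum (fun k => f k t) N + f N t)%C) => [t|].
  by rewrite CsumS.
exact: contC_plus.
Qed.

Lemma contC_translate (f : R -> C) c x : contC f (c + x) -> contC (fun t => f (c + t)) x.
Proof.
move=> H; apply: (continuous_comp (fun t => c + t) f) => //.
apply: (@continuous_plus R_UniformSpace R_AbsRing R_NormedModule);
  [exact: continuous_const | exact: continuous_id].
Qed.

Lemma is_derC_cont (f : R -> C) x l : is_derC f x l -> contC f x.
Proof. by move=> H; apply: (@ex_derive_continuous R_AbsRing C_R_NormedModule); exists l. Qed.

Lemma is_derC_RtoC (f : R -> R) x l : is_derive f x l -> is_derC (fun t => RtoC (f t)) x (RtoC l).
Proof.
move=> H; apply/is_derive_components; split => //=.
exact: (@is_derive_const R_AbsRing R_NormedModule).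
Qed.

Lemma is_derC_const (c : C) (x : R) : is_derC (fun=> c) x (RtoC 0).
Proof. exact: (@is_derive_const R_AbsRing C_R_NormedModule). Qed.

Lemma is_derC_translate (f : R -> C) c x l : is_derC f (c + x) l -> is_derC (fun t => f (c + t)) x l.
Proof.
move=> /is_deriveP H; apply/is_deriveP => e e0; have [d d0 Hd] := H e e0.
by exists d => // h hd; rewrite -Rplus_assoc; apply: Hd.
Qed.

Lemma intC_correct (f : R -> C) (a b : R) : a <= b ->
  (forall t, a <= t <= b -> contC f t) -> is_intC f a b (intC f a b).
Proof.
move=> ab H; apply: (@RInt_correct C_R_CompleteNormedModule).
apply: (@ex_RInt_continuous C_R_CompleteNormedModule) => t.
rewrite Rmin_left // Rmax_right //; exact: H.
Qed.

Lemma intC_unique (f : R -> C) (a b : R) l : is_intC f a b l -> intC f a b = l.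
Proof. exact: (@is_RInt_unique C_R_CompleteNormedModule). Qed.

Lemma is_intC_plus (f g : R -> C) (a b : R) l m :
  is_intC f a b l -> is_intC g a b m -> is_intC (fun t => f t + g t)%C a b (l + m)%C.
Proof. exact: (@is_RInt_plus C_R_NormedModule). Qed.

Lemma is_intC_ext (f g : R -> C) (a b : R) (l : C) :
  (forall t, f t = g t) -> is_intC f a b l -> is_intC g a b l.
Proof. by move=> e; apply: is_RInt_ext => t _; exact: e. Qed.

Lemma is_intC_ext_in (f g : R -> C) (a b : R) (l : C) : a <= b ->
  (forall t, a < t < b -> f t = g t) -> is_intC f a b l -> is_intC g a b l.
Proof.
by move=> ab e; apply: is_RInt_ext => t; rewrite Rmin_left // Rmax_right //; exact: e.
Qed.

Lemma contC_ext (f g : R -> C) (x : R) : (forall t, f t = g t) -> contC f x -> contC g x.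
Proof. by move=> e; apply: continuous_ext => t; exact: e. Qed.

Lemma is_intC_scal c (f : R -> C) (a b : R) l :
  is_intC f a b l -> is_intC (fun t => c * f t)%C a b (c * l)%C.
Proof.
move=> H.
have H1 := is_RInt_fct_extend_fst f a b l H.
have H2 := is_RInt_fct_extend_snd f a b l H.
apply: (@is_RInt_fct_extend_pair R_NormedModule R_NormedModule) => /=.
- apply: (@is_RInt_minus R_NormedModule); exact: (@is_RInt_scal R_NormedModule).
- apply: (@is_RInt_plus R_NormedModule); exact: (@is_RInt_scal R_NormedModule).
Qed.

Lemma Cmod_intC_le (f : R -> C) M l :
  (forall t, 0 <= t <= 1 -> Cmod (f t) <= M) -> is_intC f 0 1 l -> Cmod l <= M.
Proof.
move=> H I; have := norm_RInt_le_const f 0 1 l M Rle_0_1 _ I.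
rewrite -Cmod_norm Rminus_0_r Rmult_1_l; apply=> t Ht; rewrite -Cmod_norm; exact: H.
Qed.

Lemma is_derC_eq (f : R -> C) (x : R) (l l' : C) : is_derC f x l -> l = l' -> is_derC f x l'.
Proof. by move=> ? <-. Qed.

(** * The kernels u^-w and their Taylor coefficients in w *)

Lemma Rcpow_succ w u : 0 < u -> Rcpow u (- (w + 1)) = (Rcpow u (- w) / u)%C.
Proof.
move=> u0; rewrite /Rcpow; have -> : (- (w + 1) * ln u = - w * ln u + RtoC (- ln u))%C.
  by rewrite RtoC_opp; ring.
by rewrite Cexp_add Cexp_real exp_Ropp exp_ln // RtoC_inv //; lra.
Qed.

Lemma is_derC_Rcpow w (u : R) : 0 < u ->
  is_derC (fun u => Rcpow u (- w)) u (- w * Rcpow u (- (w + 1)))%C.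
Proof.
move=> u0.
have H1 : is_derC (fun u => - w * RtoC (ln u))%C u (0 * RtoC (ln u) + (- w) * RtoC (/ u))%C.
  apply: (is_derive_Cmult (f := fun=> (- w)%C)); first exact: is_derC_const.
  by apply: is_derC_RtoC; apply: is_derive_ln.
apply: (is_derC_eq (is_derive_C_comp (C_is_derive_Cexp _) H1)).
rewrite Rcpow_succ // RtoC_inv; [by rewrite /Rcpow; field; move=> /(f_equal fst) /=; lra | lra].
Qed.

(** The coefficient of (w - c)^k in the expansion of u^-w. *)
Definition log_kernel (c : R) (k : nat) (u : R) : C :=
  (exp_term (- ln u)%R k * Rcpow u (- c))%C.

Lemma is_derC_exp_term_ln k u : 0 < u ->
  is_derC (fun u => exp_term (- ln u)%R k.+1) u (- / u * exp_term (- ln u)%R k)%C.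
Proof.
move=> u0.
have H := is_derive_Cpow_line 1 (- ln u) k.
have L : is_derive (fun u => - ln u) u (- / u).
  by apply: (@is_derive_opp R_AbsRing R_NormedModule); apply: is_derive_ln.
have := is_derive_comp (V := C_R_NormedModule) _ _ _ _ _ H L.
rewrite !Cmult_1_r !Cmult_1_l.
have -> : @scal R_AbsRing C_R_NormedModule (- / u) (exp_term (- ln u)%R k)
   = (- / u * exp_term (- ln u)%R k)%C.
  rewrite -RtoC_inv; last lra.
  rewrite -RtoC_opp; case: (exp_term _ _) => a b.
  by rewrite /scal /= /prod_scal /scal /= /mult /= /Cmult /=; congr pair; ring.
by apply: is_derive_ext => t; rewrite Cmult_1_r.
Qed.

Lemma is_derC_log_kernel0 c u : 0 < u ->
  is_derC (log_kernel c 0) u (- c * log_kernel (c + 1) 0 u)%C.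
Proof.
move=> u0; have := is_derC_Rcpow c u0.
have E v d : log_kernel d 0 v = Rcpow v (- d).
  by rewrite /log_kernel /exp_term /= Rinv_1; ring.
rewrite E RtoC_plus; apply: is_derive_ext => t; by rewrite E.
Qed.

(** This is the coefficient of (w - c)^(k+1) in the identity (u^-w)' = - w u^(-w-1),
with w = c + (w - c). *)
Lemma is_derC_log_kernelS c k u : 0 < u ->
  is_derC (log_kernel c k.+1) u
    (- (c * log_kernel (c + 1) k.+1 u + log_kernel (c + 1) k u))%C.
Proof.
move=> u0.
apply: (is_derC_eq (is_derive_Cmult (is_derC_exp_term_ln k u0) (is_derC_Rcpow c u0))).
rewrite /log_kernel RtoC_plus Rcpow_succ //.
field; by move=> /(f_equal fst) /=; lra.
Qed.

(** * Weighted sums of cells and summation by parts *)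

Definition cont_pos (psi : R -> C) : Prop := forall u, 0 < u -> contC psi u.

Definition cell (p : C) (b psi : R -> C) (m : nat) : C :=
  (p * psi (INR m.+1) + intC (fun t => b t * psi (INR m.+1 + t)%R) 0 1)%C.

(** Cell m lives on [m + 1, m + 2]; its natural phase is z^(m+1), and the common factor z is
put back only when the sums are compared with a series. *)
Definition cell_sum (z p : C) (b psi : R -> C) (n : nat) : C :=
  Csum (fun m => z ^ m * cell p b psi m)%C n.

(** For z = 1 no oscillation of z^m makes the sums converge, so the cells themselves must
be small when psi varies slowly; a cell with psi = 1 is p + integral of b. *)
Definition balanced (z p : C) (b : R -> C) : Prop :=
  (forall t, contC b t) /\ (z = 1 -> (p + intC b 0 1 = 0)%C).

Lemma INR_S_ge1 m : 1 <= INR m.+1.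
Proof. by rewrite S_INR; have := pos_INR m; lra. Qed.

Lemma cell_integrable (b psi : R -> C) m : (forall t, contC b t) -> cont_pos psi ->
  forall t, 0 <= t <= 1 -> contC (fun t => b t * psi (INR m.+1 + t)%R)%C t.
Proof.
move=> Hb Hp t Ht; apply: contC_mult; first exact: Hb.
by apply: contC_translate; apply: Hp; have := INR_S_ge1 m; lra.
Qed.

Lemma cell_is_int (b psi : R -> C) m : (forall t, contC b t) -> cont_pos psi ->
  is_intC (fun t => b t * psi (INR m.+1 + t)%R)%C 0 1
    (intC (fun t => b t * psi (INR m.+1 + t)%R)%C 0 1).
Proof. by move=> Hb Hp; apply: intC_correct => [|t Ht]; [lra | exact: cell_integrable]. Qed.

Lemma cell_plus p b f g m : (forall t, contC b t) -> cont_pos f -> cont_pos g ->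
  cell p b (fun u => f u + g u)%C m = (cell p b f m + cell p b g m)%C.
Proof.
move=> Hb Hf Hg; rewrite /cell.
have H := is_intC_plus (cell_is_int (m := m) Hb Hf) (cell_is_int (m := m) Hb Hg).
rewrite (intC_unique (l := (intC (fun t => b t * f (INR m.+1 + t)%R)%C 0 1
  + intC (fun t => b t * g (INR m.+1 + t)%R)%C 0 1)%C)); first by ring.
by apply: is_intC_ext H => t; ring.
Qed.

Lemma cell_scal p b c f m : (forall t, contC b t) -> cont_pos f ->
  cell p b (fun u => c * f u)%C m = (c * cell p b f m)%C.
Proof.
move=> Hb Hf; rewrite /cell.
have H := is_intC_scal (c := c) (cell_is_int (m := m) Hb Hf).
rewrite (intC_unique (l := (c * intC (fun t => b t * f (INR m.+1 + t)%R)%C 0 1)%C));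
  first by ring.
by apply: is_intC_ext H => t; ring.
Qed.

Lemma cell_ext p b f g m : (forall u, 0 < u -> f u = g u) -> cell p b f m = cell p b g m.
Proof.
move=> e; rewrite /cell e; last by have := INR_S_ge1 m; lra.
congr (_ + _)%C; apply: (@RInt_ext C_R_CompleteNormedModule) => t; rewrite Rmin_left ?Rmax_right; try lra.
by move=> Ht; rewrite e //; have := INR_S_ge1 m; lra.
Qed.

Lemma cont_pos_scal c f : cont_pos f -> cont_pos (fun u => c * f u)%C.
Proof. by move=> H u u0; apply: contC_mult; [exact: contC_const | exact: H]. Qed.

Lemma cont_pos_Csum N (f : nat -> R -> C) : (forall k, cont_pos (f k)) ->
  cont_pos (fun u => Csum (fun k => f k u) N).
Proof. by move=> H u u0; apply: contC_sum => k; apply: H. Qed.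

Lemma cell_sum_plus z p b f g n : (forall t, contC b t) -> cont_pos f -> cont_pos g ->
  cell_sum z p b (fun u => f u + g u)%C n = (cell_sum z p b f n + cell_sum z p b g n)%C.
Proof.
move=> Hb Hf Hg; rewrite /cell_sum -Csum_plus; apply: Csum_ext => m.
by rewrite cell_plus //; ring.
Qed.

Lemma cell_sum_scal z p b c f n : (forall t, contC b t) -> cont_pos f ->
  cell_sum z p b (fun u => c * f u)%C n = (c * cell_sum z p b f n)%C.
Proof.
move=> Hb Hf; rewrite /cell_sum -Csum_scal; apply: Csum_ext => m.
by rewrite cell_scal //; ring.
Qed.

Lemma cell_sum_ext z p b f g n : (forall u, 0 < u -> f u = g u) ->
  cell_sum z p b f n = cell_sum z p b g n.
Proof. by move=> e; apply: Csum_ext => m; rewrite (cell_ext _ _ _ e). Qed.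

Lemma cell_sum_lin z p b (a : nat -> C) (f : nat -> R -> C) N n :
  (forall t, contC b t) -> (forall k, cont_pos (f k)) ->
  cell_sum z p b (fun u => Csum (fun k => a k * f k u)%C N) n =
  Csum (fun k => a k * cell_sum z p b (f k) n)%C N.
Proof.
move=> Hb Hf; elim: N => [|N IH].
  rewrite Csum0 (@cell_sum_ext _ _ _ _ (fun u => 0 * f O u)%C).
    by rewrite cell_sum_scal //; ring.
  by move=> u _; rewrite Csum0; ring.
rewrite CsumS -IH -cell_sum_scal // -cell_sum_plus //; last exact: cont_pos_scal.
  by apply: cell_sum_ext => u _; rewrite CsumS.
by apply: (cont_pos_Csum (f := fun k u => a k * f k u)%C) => k; apply: cont_pos_scal.
Qed.

(** For z <> 1 the equation on B(1) determines the constant of integration. For z = 1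
it holds for every constant, thanks to the balance of (p, b), and the constant is
spent on making the integral of B vanish. *)
Lemma balanced_antiderivative (z p : C) (b : R -> C) : balanced z p b ->
  exists B : R -> C, [/\ forall t, is_derC B t (b t),
    B 1 = (z * (B 0 - p))%C & balanced z 0 B].
Proof.
move=> [Hb Hz].
pose B0 t := intC b 0 t.
have dB0 c t : is_derC (fun t => c + B0 t)%C t (b t).
  have -> : b t = @plus C_R_NormedModule (RtoC 0) (b t).
    by rewrite -[RHS]/(0 + b t)%C Cplus_0_l.
  apply: (@is_derive_plus R_AbsRing C_R_NormedModule (fun=> c) B0); first exact: is_derC_const.
  apply: (@is_derive_RInt C_R_NormedModule b _ 0); last exact: Hb.
  apply: filter_forall => x; apply: (@RInt_correct C_R_CompleteNormedModule).
  by apply: (@ex_RInt_continuous C_R_CompleteNormedModule) => u _; exact: Hb.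
have B00 : B0 0 = 0.
  apply: intC_unique; exact: (@is_RInt_point C_R_NormedModule).
have cB c t : contC (fun t => c + B0 t)%C t := is_derC_cont (dB0 c t).
have [z1|z1] := excluded_middle_informative (z = 1).
- pose c := (- intC B0 0 1)%C.
  exists (fun t => c + B0 t)%C; split => //.
    rewrite z1 B00; have := Hz z1; rewrite -/(B0 1) => E.
    have -> : B0 1 = (p + B0 1 - p)%C by ring.
    by rewrite E; ring.
  split=> // _.
  have cB0 t : contC B0 t by apply: (@contC_ext (fun t => 0 + B0 t)%C) => // u; ring.
  have I0 : is_intC B0 0 1 (intC B0 0 1) by apply: intC_correct => //; lra.
  have Ic : is_intC (fun=> c) 0 1 c.
    have := is_RInt_const 0 1 (c : C_R_NormedModule).
    have -> : @scal R_AbsRing C_R_NormedModule (1 - 0)%R c = c.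
      rewrite Rminus_0_r; exact: (@scal_one R_AbsRing C_R_NormedModule).
    by [].
  rewrite (intC_unique (is_intC_plus Ic I0)) /c; ring.
- have z1' : (1 - z <> 0)%C.
    move=> E; apply: z1; have -> : z = (1 - (1 - z))%C by ring.
    by rewrite E; ring.
  pose c := ((- z * p - B0 1) / (1 - z))%C.
  exists (fun t => c + B0 t)%C; split => //.
  by rewrite B00 /c; field.
Qed.

(** Integration by parts in each cell; the choice of B(1) makes the boundary terms
of neighbouring cells cancel. *)
Lemma cell_by_parts (z p : C) (b B psi dpsi : R -> C) n :
  (forall t, contC b t) -> (forall t, is_derC B t (b t)) -> B 1 = (z * (B 0 - p))%C ->
  (forall u, 0 < u -> is_derC psi u (dpsi u)) -> cont_pos dpsi ->
  cell_sum z p b psi n =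
  ((p - B 0) * (psi 1 - z ^ n * psi (INR n.+1)) - cell_sum z 0 B dpsi n)%C.
Proof.
move=> Hb dB B1 dpsi_ cdpsi.
have cpsi : cont_pos psi by move=> u u0; apply: is_derC_cont (dpsi_ u u0).
have cB t : contC B t := is_derC_cont (dB t).
have step m : cell p b psi m =
    ((p - B 0) * psi (INR m.+1) + B 1 * psi (INR m.+2) - cell 0 B dpsi m)%C.
  have Ib := cell_is_int (m := m) Hb cpsi.
  have IB := cell_is_int (m := m) cB cdpsi.
  have Isum := is_intC_plus Ib IB.
  have Ider : is_intC (fun t => b t * psi (INR m.+1 + t)%R + B t * dpsi (INR m.+1 + t)%R)%C 0 1
     (B 1 * psi (INR m.+1 + 1)%R - B 0 * psi (INR m.+1 + 0)%R)%C.
    apply: (@is_RInt_derive C_R_CompleteNormedModule (fun t => B t * psi (INR m.+1 + t)%R)%C)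
      => t; rewrite Rmin_left ?Rmax_right; try lra; move=> Ht.
    - apply: is_derive_Cmult => //; apply: is_derC_translate; apply: dpsi_.
      by have := INR_S_ge1 m; lra.
    - by apply: contC_plus; exact: cell_integrable.
  have E : (intC (fun t => b t * psi (INR m.+1 + t)%R)%C 0 1
     + intC (fun t => B t * dpsi (INR m.+1 + t)%R)%C 0 1
     = B 1 * psi (INR m.+2) - B 0 * psi (INR m.+1))%C.
    rewrite -(intC_unique Isum) (intC_unique Ider) (S_INR m.+1).
    by rewrite Rplus_0_r.
  rewrite /cell.
  have -> : intC (fun t => b t * psi (INR m.+1 + t)%R)%C 0 1 =
   (B 1 * psi (INR m.+2) - B 0 * psi (INR m.+1)
    - intC (fun t => B t * dpsi (INR m.+1 + t)%R)%C 0 1)%C by rewrite -E; ring.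
  ring.
elim: n => [|n IH].
  by rewrite /cell_sum !Csum0 /=; ring.
by rewrite /cell_sum !CsumS -!/(cell_sum _ _ _ _ n) IH step B1 Cpow_S; ring.
Qed.

(** * Absolute convergence *)

Lemma bigR_inv_sq_le n : \big[Rplus/0]_(k < n) (/ INR k.+1 ^ 2) <= 2.
Proof.
case: n => [|n]; first by rewrite big_ord0; lra.
suff : \big[Rplus/0]_(k < n.+1) (/ INR k.+1 ^ 2) <= 2 - / INR n.+1.
  have : 0 < / INR n.+1 by apply: Rinv_0_lt_compat; have := INR_S_ge1 n; lra.
  lra.
elim: n => [|n IH].
  by rewrite big_ord_recr big_ord0 /= !Rmult_1_r Rinv_1; lra.
have -> : \big[Rplus/0]_(k < n.+2) (/ INR k.+1 ^ 2)
    = \big[Rplus/0]_(k < n.+1) (/ INR k.+1 ^ 2) + / INR n.+2 ^ 2 by rewrite big_ord_recr.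
have n1 := INR_S_ge1 n.
have E : INR n.+2 = INR n.+1 + 1 by exact: S_INR.
(* Comparison with a telescoping sum. *)
have : / INR n.+2 ^ 2 <= / INR n.+1 - / INR n.+2.
  have -> : / INR n.+1 - / INR n.+2 = / (INR n.+1 * INR n.+2) by rewrite E; field; lra.
  by apply: Rinv_le_contravar; rewrite E; nra.
lra.
Qed.

Lemma ex_series_inv_sq (c : R) : ex_series (fun k => c * / INR k.+1 ^ 2).
Proof.
apply: ex_series_scal.
have E n : sum_n (fun k => / INR k.+1 ^ 2) n = \big[Rplus/0]_(k < n.+1) (/ INR k.+1 ^ 2).
  elim: n => [|n IH]; first by rewrite sum_O big_ord_recr big_ord0 /= Rplus_0_l.
  by rewrite sum_Sn IH [in RHS]big_ord_recr.
have [l Hl] : ex_finite_lim_seq (sum_n (fun k => / INR k.+1 ^ 2)).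
  apply: (ex_finite_lim_seq_incr _ 2) => n; last by rewrite E; exact: bigR_inv_sq_le.
  rewrite sum_Sn /plus /=.
  have : 0 < / INR n.+2 ^ 2.
    by apply: Rinv_0_lt_compat; apply: pow_lt; have := INR_S_ge1 n.+1; lra.
  rewrite /=; lra.
by exists l.
Qed.

(** Decay that makes the sums over cells converge absolutely. *)
Definition inv_sq_bounded (psi : R -> C) (M : R) : Prop :=
  forall u, 1 <= u -> Cmod (psi u) <= M * / u ^ 2.

Lemma is_lim_seq_inv_sq (c : R) : is_lim_seq (fun n => c * / INR n.+1 ^ 2) 0.
Proof. exact: ex_series_lim_0 (ex_series_inv_sq c). Qed.

Lemma cell_le (p : C) (b : R -> C) : (forall t, contC b t) ->
  exists2 K, 0 <= K & forall psi M m, cont_pos psi -> inv_sq_bounded psi M ->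
    Cmod (cell p b psi m) <= K * M * / INR m.+1 ^ 2.
Proof.
move=> Hb.
have [Mb HMb] := @bounded_continuity R_AbsRing C_R_NormedModule b 0 1 (fun t _ => Hb t).
have Mb0 : 0 <= Mb.
  by have := HMb 0 ltac:(lra); rewrite -Cmod_norm; have := Cmod_ge_0 (b 0); lra.
have p0 := Cmod_ge_0 p.
exists (Cmod p + Mb); first lra.
move=> psi M m cpsi Hpsi.
have m1 := INR_S_ge1 m.
have M0 : 0 <= M.
  by have := Hpsi 1 ltac:(lra); rewrite pow1 Rinv_1; have := Cmod_ge_0 (psi 1); lra.
have mono u : INR m.+1 <= u -> Cmod (psi u) <= M * / INR m.+1 ^ 2.
  move=> Hu; apply: Rle_trans (Hpsi u ltac:(lra)) _; apply: Rmult_le_compat_l => //.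
  by apply: Rinv_le_contravar; [apply: pow_lt; lra | apply: pow_incr; lra].
apply: Rle_trans (Cmod_triangle _ _) _.
have H1 : Cmod (p * psi (INR m.+1)) <= Cmod p * (M * / INR m.+1 ^ 2).
  by rewrite Cmod_mult; apply: Rmult_le_compat_l => //; apply: mono; lra.
have H2 : Cmod (intC (fun t => b t * psi (INR m.+1 + t)%R)%C 0 1) <= Mb * (M * / INR m.+1 ^ 2).
  apply: (Cmod_intC_le _ (cell_is_int (m := m) Hb cpsi)) => t Ht; rewrite Cmod_mult.
  apply: Rmult_le_compat; try exact: Cmod_ge_0; last by apply: mono; lra.
  by apply: Rlt_le; have := HMb t Ht; rewrite -Cmod_norm.
lra.
Qed.

(** One constant serves all psi, so bounds on kernels pass to bounds on limits of
sums with the same dependence on k or on the order of the remainder. *)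
Lemma cell_sum_le (z p : C) (b : R -> C) : Cmod z = 1 -> (forall t, contC b t) ->
  exists2 K, 0 <= K & forall psi M, cont_pos psi -> inv_sq_bounded psi M -> 0 <= M ->
    (forall n, Cmod (cell_sum z p b psi n) <= K * M) /\
    exists l, Clim (cell_sum z p b psi) l.
Proof.
move=> z1 Hb; have [K K0 HK] := cell_le p Hb.
exists (2 * K); first lra.
move=> psi M cpsi Hpsi M0.
have T m : Cmod (z ^ m * cell p b psi m) <= K * M * / INR m.+1 ^ 2.
  by rewrite Cmod_mult Cmod_pow z1 pow1 Rmult_1_l; exact: HK.
split; last by apply: Clim_abs_series T _; exact: ex_series_inv_sq.
move=> n; apply: (@Cmod_Csum_le _ (fun m => K * M * / INR m.+1 ^ 2)) => // {}n.
rewrite -big_distrr.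
have := bigR_inv_sq_le n; have := Rmult_le_pos _ _ K0 M0; rewrite /=; nra.
Qed.

Lemma Cmod_Rcpow u w : Cmod (Rcpow u w) = exp (Re w * ln u).
Proof. by rewrite /Rcpow Cmod_Cexp; congr exp; rewrite /Re /Cmult /=; ring. Qed.

Lemma exp_ln_inv_sq u : 0 < u -> exp (- 2 * ln u) = / u ^ 2.
Proof.
move=> u0; have -> : - 2 * ln u = - (ln u + ln u) by ring.
by rewrite exp_Ropp exp_plus exp_ln //= Rmult_1_r.
Qed.

Lemma Rcpow_inv_sq w : 2 <= Re w -> inv_sq_bounded (fun u => Rcpow u (- w)) 1.
Proof.
move=> w2 u u1; rewrite Cmod_Rcpow Rmult_1_l -exp_ln_inv_sq; last lra.
have l0 : 0 <= ln u by rewrite -ln_1; apply: ln_le; lra.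
have -> : Re (- w) = - Re w by [].
have : - Re w * ln u <= - 2 * ln u by nra.
case=> [/exp_increasing|->]; lra.
Qed.

Lemma log_kernel_remainder w (c : R) N u :
  (Rcpow u (- w) - Csum (fun k => (w - c) ^ k * log_kernel c k u) N
   = Rcpow u (- c) * exp_rem ((w - c) * (- ln u)%R) N)%C.
Proof.
have -> : Rcpow u (- w) = (Rcpow u (- c) * Cexp ((w - c) * (- ln u)%R))%C.
  by rewrite /Rcpow -Cexp_add; congr Cexp; rewrite RtoC_opp; ring.
rewrite /exp_rem -/(Csum (exp_term ((w - c) * (- ln u)%R)) N).
have -> : Csum (fun k => (w - c) ^ k * log_kernel c k u)%C N
  = (Rcpow u (- c) * Csum (exp_term ((w - c) * (- ln u)%R)) N)%C.
  rewrite -Csum_scal; apply: Csum_ext => k.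
  by rewrite /log_kernel /exp_term Cpow_mult_l; ring.
ring.
Qed.

Lemma remainder_inv_sq (c q : R) (w : C) N : 2 <= c -> 0 <= q <= 1 ->
  Cmod (w - c) <= q * (c - 2) ->
  inv_sq_bounded (fun u => Rcpow u (- w) - Csum (fun k => (w - c) ^ k * log_kernel c k u) N)%C
    (q ^ N).
Proof.
move=> c2 q01 Hq u u1; rewrite log_kernel_remainder Cmod_mult Cmod_Rcpow.
have l0 : 0 <= ln u by rewrite -ln_1; apply: ln_le; lra.
have H : Cmod (exp_rem ((w - c) * (- ln u)%R) N) <= q ^ N * exp ((c - 2) * ln u).
  apply: Cmod_exp_rem_le => //; first by nra.
  rewrite Cmod_mult Cmod_R Rabs_Ropp Rabs_pos_eq //.
  have := Rmult_le_compat_r _ _ _ l0 Hq; lra.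
apply: Rle_trans (Rmult_le_compat_l _ _ _ (Rlt_le _ _ (exp_pos _)) H) _.
rewrite -exp_ln_inv_sq; last lra.
have -> : Re (- RtoC c) = - c by [].
have -> : exp (- 2 * ln u) = exp (- c * ln u) * exp ((c - 2) * ln u).
  by rewrite -exp_plus; congr exp; ring.
right; ring.
Qed.

Lemma log_kernel_inv_sq (c : R) k : 3 <= c ->
  inv_sq_bounded (log_kernel c k) (2 * (/ (c - 2)) ^ k).
Proof.
move=> c3 u u1; rewrite /log_kernel Cmod_mult Cmod_Rcpow.
have l0 : 0 <= ln u by rewrite -ln_1; apply: ln_le; lra.
set q := / (c - 2).
have q0 : 0 < q by apply: Rinv_0_lt_compat; lra.
have q1 : q <= 1 by rewrite -Rinv_1; apply: Rinv_le_contravar; lra.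
have X : Cmod (- ln u)%R <= q * ((c - 2) * ln u).
  by rewrite Cmod_R Rabs_Ropp Rabs_pos_eq // /q; right; field; lra.
have Y : 0 <= (c - 2) * ln u by nra.
have H : Cmod (exp_term (- ln u)%R k) <= 2 * q ^ k * exp ((c - 2) * ln u).
  (* A term is the difference of two consecutive remainders, both already estimated. *)
  have -> : exp_term (- ln u)%R k = (exp_rem (- ln u)%R k - exp_rem (- ln u)%R k.+1)%C.
    by rewrite /exp_rem big_ord_recr /=; ring.
  apply: Rle_trans (Cmod_triangle_sub _ _) _.
  have := @Cmod_exp_rem_le (- ln u)%R q _ k ltac:(lra) Y X.
  have := @Cmod_exp_rem_le (- ln u)%R q _ k.+1 ltac:(lra) Y X.
  have P := pow_le q k (Rlt_le _ _ q0); have E := exp_pos ((c - 2) * ln u).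
  have : q ^ k.+1 * exp ((c - 2) * ln u) <= q ^ k * exp ((c - 2) * ln u).
    by apply: Rmult_le_compat_r; [lra | rewrite /=; nra].
  lra.
apply: Rle_trans (Rmult_le_compat_r _ _ _ (Rlt_le _ _ (exp_pos _)) H) _.
rewrite -exp_ln_inv_sq; last lra.
have -> : Re (- RtoC c) = - c by [].
have -> : exp (- 2 * ln u) = exp (- c * ln u) * exp ((c - 2) * ln u).
  by rewrite -exp_plus; congr exp; ring.
right; ring.
Qed.

Lemma cont_pos_Rcpow w : cont_pos (fun u => Rcpow u (- w)).
Proof. by move=> u u0; apply: is_derC_cont (is_derC_Rcpow w u0). Qed.

Lemma cont_pos_log_kernel c k : cont_pos (log_kernel c k).
Proof.
move=> u u0; case: k => [|k].
  exact: is_derC_cont (is_derC_log_kernel0 c u0).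
exact: is_derC_cont (is_derC_log_kernelS c k u0).
Qed.

Lemma log_kernel_at1 c k : log_kernel c k 1 = if k is O then RtoC 1 else RtoC 0.
Proof.
rewrite /log_kernel /Rcpow ln_1 Ropp_0 Cmult_0_r Cexp_0 Cmult_1_r /exp_term.
case: k => [|k]; first by rewrite /= Rinv_1; ring.
by rewrite Cpow_S; ring.
Qed.

(** * Taylor coefficients of the sums *)

(** The boundary term at n tends to 0 by the decay of psi. *)
Lemma Clim_by_parts (z p : C) (b B psi dpsi : R -> C) M l : Cmod z = 1 ->
  (forall t, contC b t) -> (forall t, is_derC B t (b t)) -> B 1 = (z * (B 0 - p))%C ->
  (forall u, 0 < u -> is_derC psi u (dpsi u)) -> cont_pos dpsi -> inv_sq_bounded psi M ->
  Clim (cell_sum z 0 B dpsi) l ->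
  Clim (cell_sum z p b psi) ((p - B 0) * psi 1 - l)%C.
Proof.
move=> z1 Hb dB B1 Hpsi cdpsi bpsi Hl.
have V : Clim (fun n => z ^ n * psi (INR n.+1))%C 0.
  apply: (@Clim_le _ _ (fun n => M * / INR n.+1 ^ 2)); last exact: is_lim_seq_inv_sq.
  move=> n; have -> : (z ^ n * psi (INR n.+1) - 0 = z ^ n * psi (INR n.+1))%C by ring.
  by rewrite Cmod_mult Cmod_pow z1 pow1 Rmult_1_l; apply: bpsi; exact: INR_S_ge1.
have -> : ((p - B 0) * psi 1 = (p - B 0) * (psi 1 - 0))%C by ring.
apply: Clim_ext (Clim_minus (Clim_scal _ (Clim_minus (Clim_const _) V)) Hl) => n.
by rewrite (cell_by_parts _ Hb dB B1 Hpsi cdpsi).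
Qed.

(** The Taylor coefficients at c of the limit of the sums for u^-w. *)
Definition moments (z p : C) (b : R -> C) (c : R) (a : nat -> C) : Prop :=
  forall k, Clim (cell_sum z p b (log_kernel c k)) (a k).

(** Absolute convergence region: the expansion of u^-w at c, with remainder of order
q^N u^-2, is summed term by term. The radius c - 2 is the distance from c to the
line Re w = 2. *)
Lemma moments_base (z p : C) (b : R -> C) (c : R) :
  Cmod z = 1 -> 3 <= c -> (forall t, contC b t) ->
  exists2 a, moments z p b c a &
    (exists M, forall k, Cmod (a k) * (c - 2) ^ k <= M) /\
    forall w, 2 < Re w -> Cmod (w - c) < c - 2 ->
      exists l, Clim (cell_sum z p b (fun u => Rcpow u (- w))) l /\
        Clim (Csum (fun k => a k * (w - c) ^ k)%C) l.
Proof.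
move=> z1 c3 Hb.
have [K K0 HK] := cell_sum_le p z1 Hb.
have q0 : 0 < / (c - 2) by apply: Rinv_0_lt_compat; lra.
have HL k := HK _ _ (@cont_pos_log_kernel c k) (log_kernel_inv_sq k c3)
  ltac:(have := pow_le _ k (Rlt_le _ _ q0); lra).
pose a k := proj1_sig (constructive_indefinite_description _ (proj2 (HL k))).
have Ha : moments z p b c a.
  by move=> k; exact: (proj2_sig (constructive_indefinite_description _ (proj2 (HL k)))).
exists a => //; split.
- exists (K * 2) => k.
  have := Clim_Cmod_le (Ha k) (proj1 (HL k)).
  have P : 0 < (c - 2) ^ k by apply: pow_lt; lra.
  move=> /(Rmult_le_compat_r _ _ _ (Rlt_le _ _ P)) H; apply: Rle_trans H _.
  by rewrite pow_inv; right; field; lra.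
- move=> w w2 Hw.
  have [_ [l Hl]] := HK _ _ (@cont_pos_Rcpow w) (Rcpow_inv_sq (Rlt_le _ _ w2)) Rle_0_1.
  exists l; split => //.
  pose q := Cmod (w - c) / (c - 2).
  have m0 := Cmod_ge_0 (w - c).
  have q01 : 0 <= q < 1.
    split; first by apply: Rmult_le_pos; lra.
    by rewrite /q; apply: (Rmult_lt_reg_r (c - 2)); [lra | field_simplify; lra].
  have Hq : Cmod (w - c) <= q * (c - 2) by rewrite /q; right; field; lra.
  apply: (@Clim_le _ _ (fun n => K * q ^ n)); last exact: is_lim_seq_geom0.
  move=> N; rewrite Cmod_minus_sym.
  have L : Clim (fun n => cell_sum z p b (fun u => Rcpow u (- w)
      - Csum (fun k => (w - c) ^ k * log_kernel c k u) N)%C n)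
      (l - Csum (fun k => a k * (w - c) ^ k)%C N)%C.
    have E : Csum (fun k => a k * (w - c) ^ k)%C N = Csum (fun k => (w - c) ^ k * a k)%C N.
      by apply: Csum_ext => k; ring.
    rewrite E; apply: Clim_ext (Clim_minus Hl (Clim_sum N (fun k => Clim_scal ((w - c) ^ k)%C (Ha k)))).
    move=> n; rewrite -cell_sum_lin //; last by move=> k; exact: cont_pos_log_kernel.
    have -> : forall x y : C, (x - y = x + (- (1)) * y)%C by move=> x y; ring.
    have cS : cont_pos (fun u => Csum (fun k => (w - c) ^ k * log_kernel c k u)%C N).
      apply: (cont_pos_Csum (f := fun k u => (w - c) ^ k * log_kernel c k u)%C) => k.
      by apply: cont_pos_scal; exact: cont_pos_log_kernel.
    rewrite -cell_sum_scal // -cell_sum_plus //; last exact: cont_pos_scal.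
      by apply: cell_sum_ext => u _; ring.
    exact: cont_pos_Rcpow.
  apply: Clim_Cmod_le L _.
  have cR : cont_pos (fun u => Rcpow u (- w)
      - Csum (fun k => (w - c) ^ k * log_kernel c k u) N)%C.
    move=> u u0; apply: contC_minus; first exact: cont_pos_Rcpow.
    apply: (contC_sum (f := fun k u => (w - c) ^ k * log_kernel c k u)%C) => k.
    by apply: contC_mult; [exact: contC_const | exact: cont_pos_log_kernel].
  have bR : inv_sq_bounded _ _ := remainder_inv_sq N (ltac:(lra) : 2 <= c) (ltac:(lra) : 0 <= q <= 1) Hq.
  exact: (proj1 (HK _ _ cR bR (pow_le _ N (proj1 q01)))).
Qed.

(** The coefficients of the relation D(w) = p - B(0) + w D'(w + 1) between the limits
D for (p, b) and D' for (0, B), where w = c + (w - c). *)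
Lemma moments_step (z p : C) (b B : R -> C) (c : R) (a a' : nat -> C) :
  Cmod z = 1 -> 3 <= c -> (forall t, contC b t) ->
  (forall t, is_derC B t (b t)) -> B 1 = (z * (B 0 - p))%C ->
  moments z p b c a -> moments z 0 B (c + 1) a' ->
  a O = (p - B 0 + c * a' O)%C /\ forall k, a k.+1 = (c * a' k.+1 + a' k)%C.
Proof.
move=> z1 c3 Hb dB B1 Ha Ha'.
have cB t : contC B t := is_derC_cont (dB t).
have cL k := @cont_pos_log_kernel (c + 1) k.
split.
- apply: Clim_unique (Ha O) _.
  have -> : (p - B 0 + c * a' O = (p - B 0) * log_kernel c 0 1 - - c * a' O)%C.
    by rewrite log_kernel_at1; ring.
  apply: (@Clim_by_parts z p b B (log_kernel c 0) (fun u => - c * log_kernel (c + 1) 0 u)%C _ _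
    z1 Hb dB B1 _ _ (log_kernel_inv_sq O c3)).
  + by move=> u; exact: is_derC_log_kernel0.
  + exact: cont_pos_scal.
  + by apply: Clim_ext (Clim_scal _ (Ha' O)) => n; rewrite cell_sum_scal.
- move=> k; apply: Clim_unique (Ha k.+1) _.
  have -> : (c * a' k.+1 + a' k
     = (p - B 0) * log_kernel c k.+1 1 - (- c * a' k.+1 + - (1) * a' k))%C.
    by rewrite log_kernel_at1; ring.
  apply: (@Clim_by_parts z p b B (log_kernel c k.+1)
    (fun u => - c * log_kernel (c + 1) k.+1 u + - (1) * log_kernel (c + 1) k u)%C _ _
    z1 Hb dB B1 _ _ (log_kernel_inv_sq k.+1 c3)).
  + by move=> u u0; apply: (is_derC_eq (is_derC_log_kernelS c k u0)); ring.
  + by move=> u u0; apply: contC_plus; apply: contC_mult; [exact: contC_const | exact: cL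
      | exact: contC_const | exact: cL].
  + apply: Clim_ext (Clim_plus (Clim_scal _ (Ha' k.+1)) (Clim_scal _ (Ha' k))) => n.
    by rewrite cell_sum_plus ?cell_sum_scal //; exact: cont_pos_scal.
Qed.

(** Induction on K: one summation by parts replaces c by c + 1, so the bound known for
(0, B) at c + 1 holds with a radius one unit larger than the one known for (p, b)
at c. *)
Lemma moments_expansion (K : nat) (z p : C) (b : R -> C) (c : R) (a : nat -> C) :
  Cmod z = 1 -> 3 <= c -> balanced z p b -> moments z p b c a ->
  (exists M, forall k, Cmod (a k) * (c - 2 + INR K) ^ k <= M) /\
  forall w, 2 < Re w -> Cmod (w - c) < c - 2 + INR K ->
    exists l, Clim (cell_sum z p b (fun u => Rcpow u (- w))) l /\
      Clim (Csum (fun k => a k * (w - c) ^ k)%C) l.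
Proof.
move=> z1; elim: K p b c a => [|K IH] p b c a c3 Hbal Ha.
  have [a0 Ha0 H] := moments_base p z1 c3 (proj1 Hbal).
  have E : a = a0 by apply: FunctionalExtensionality.functional_extensionality => k;
    exact: Clim_unique (Ha k) (Ha0 k).
  by rewrite E Rplus_0_r.
have Hb := proj1 Hbal.
have [B [dB B1 HbalB]] := balanced_antiderivative Hbal.
have c13 : 3 <= c + 1 by lra.
have [a' Ha' _] := moments_base 0 z1 c13 (proj1 HbalB).
have [E0 ES] := moments_step z1 c3 Hb dB B1 Ha Ha'.
have [[M HM] Hexp] := IH _ _ _ _ c13 HbalB Ha'.
have R' : c + 1 - 2 + INR K = c - 2 + INR K.+1 by rewrite S_INR; ring.
rewrite R' in HM Hexp.
set r := c - 2 + INR K.+1 in HM Hexp *.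
have r0 : 0 < r by rewrite /r; have := pos_INR K.+1; lra.
have M0 : 0 <= M.
  by have := HM O; rewrite /= Rmult_1_r; have := Cmod_ge_0 (a' O); lra.
have pB := Cmod_ge_0 (p - B 0).
split.
- exists (Cmod (p - B 0) + c * M + r * M) => -[|k].
    rewrite E0 /= Rmult_1_r; apply: Rle_trans (Cmod_triangle _ _) _.
    rewrite Cmod_mult Cmod_R Rabs_pos_eq; last lra.
    have := HM O; rewrite /= Rmult_1_r => H.
    have := Rmult_le_compat_l c _ _ ltac:(lra) H; nra.
  have P : 0 <= r ^ k.+1 by apply: pow_le; lra.
  rewrite ES; apply: (Rle_trans _ (c * (Cmod (a' k.+1) * r ^ k.+1) + r * (Cmod (a' k) * r ^ k))).
    have := Cmod_triangle (c * a' k.+1) (a' k).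
    rewrite Cmod_mult Cmod_R Rabs_pos_eq; last lra.
    by move=> /(Rmult_le_compat_r _ _ _ P); rewrite -[r ^ k.+1]/(r * r ^ k); lra.
  have := Rmult_le_compat_l c _ _ ltac:(lra) (HM k.+1).
  have := Rmult_le_compat_l r _ _ (Rlt_le _ _ r0) (HM k).
  lra.
- move=> w w2 Hw.
  have w12 : 2 < Re (w + 1) by rewrite /Re /=; move: w2; rewrite /Re; lra.
  have Ew : ((w + 1) - (c + 1)%R = w - c)%C by rewrite RtoC_plus; ring.
  have [l [Hl1 Hl2]] := Hexp (w + 1)%C w12 ltac:(rewrite Ew; exact Hw).
  exists (p - B 0 + w * l)%C; split.
  + have -> : (p - B 0 + w * l = (p - B 0) * Rcpow 1 (- w) - - w * l)%C.
      by rewrite /Rcpow ln_1 Cmult_0_r Cexp_0; ring.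
    apply: (@Clim_by_parts z p b B (fun u => Rcpow u (- w))
      (fun u => - w * Rcpow u (- (w + 1)))%C _ _
      z1 Hb dB B1 _ _ (Rcpow_inv_sq (Rlt_le _ _ w2))).
    * by move=> u; exact: is_derC_Rcpow.
    * exact: cont_pos_scal (@cont_pos_Rcpow _).
    * apply: Clim_ext (Clim_scal _ Hl1) => n.
      by rewrite cell_sum_scal //; [exact: (proj1 HbalB) | exact: cont_pos_Rcpow].
  + apply: Clim_unshift.
    rewrite Ew in Hl2.
    have -> : (p - B 0 + w * l = p - B 0 + (c * l + (w - c) * l))%C by ring.
    apply: Clim_ext (Clim_plus (Clim_const _)
      (Clim_plus (Clim_scal _ (Clim_shift Hl2)) (Clim_scal (w - c)%C Hl2))) => n.
    rewrite !Csum_recl E0.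
    have -> : Csum (fun k => a k.+1 * (w - c) ^ k.+1)%C n
      = (c * Csum (fun k => a' k.+1 * (w - c) ^ k.+1) n
         + (w - c) * Csum (fun k => a' k * (w - c) ^ k) n)%C.
      rewrite -!Csum_scal -Csum_plus; apply: Csum_ext => k.
      by rewrite ES Cpow_S; ring.
    by rewrite /=; ring.
Qed.

(** The coefficients at the single centre 3 satisfy the bounds of every order K. *)
Lemma cell_sum_primitive (z p : C) (b : R -> C) : Cmod z = 1 -> balanced z p b ->
  exists H : C -> C, entire H /\
    forall w, 2 < Re w -> exists l,
      Clim (cell_sum z p b (fun u => Rcpow u (- w))) l /\ C_is_derive H w l.
Proof.
move=> z1 Hbal.
(* Any centre at least 3 would do: this keeps 1 / (c - 2) at most 1. *)
have [a Ha _] := moments_base p z1 (Rle_refl 3) (proj1 Hbal).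
have H K := moments_expansion K z1 (Rle_refl 3) Hbal Ha.
have above x : exists K, x < 3 - 2 + INR K.
  by have [K HK] := INR_unbounded x; exists K; lra.
have Ea : entire_coefs a.
  move=> r r0; have [K HK] := above r; have [[M HM] _] := H K; exists M => k.
  apply: Rle_trans (HM k); apply: Rmult_le_compat_l; first exact: Cmod_ge_0.
  by apply: pow_incr; lra.
have [G HG] := power_series_primitive Ea.
have GC w l : Clim (Csum (fun k => a k * (w - 3%R) ^ k)%C) l ->
    C_is_derive (fun w => G (w + (- 3%R))%C) w l.
  by move=> Hl; apply: C_is_derive_translate; apply: HG.
exists (fun w => G (w + (- 3%R))%C); split.
- move=> w.
  have r0 : 0 < Cmod (w - 3%R) + 1 by have := Cmod_ge_0 (w - 3%R); lra.
  have [K K0 HK] := entire_coefs_half Ea r0.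
  have [l Hl] : exists l, Clim (Csum (fun k => a k * (w - 3%R) ^ k)%C) l.
    apply: Clim_abs_series (ex_series_geom_half K) => k.
    apply: Rle_trans (HK k); rewrite Cmod_mult Cmod_pow.
    apply: Rmult_le_compat_l; first exact: Cmod_ge_0.
    by apply: pow_incr; have := Cmod_ge_0 (w - 3%R); lra.
  by exists l; exact: GC.
- move=> w w2; have [K HK] := above (Cmod (w - 3%R)).
  have [_ /(_ w w2 HK) [l [H1 H2]]] := H K.
  by exists l; split => //; exact: GC.
Qed.

(** * Series minus integral *)

(** Partial form of the difference of the two logarithmic derivatives, with the sign
of (zeta / zeta_disc)' / (zeta / zeta_disc). *)
Definition series_integral_gap (G : R -> C) (s : C) (n : nat) : C :=
  (Csum (fun m => G (INR m.+1) * Rcpow (INR m.+1) (- s - 1))%C n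
   - intC (fun u => G u * Rcpow u (- s) / u)%C 1 (INR n.+1))%C.

(** A class closed under linear combinations, so that each exponential monomial of the
counting function can be treated alone. It asks for a primitive of the limit,
because the logarithm of the ratio of the zeta functions is one. *)
Definition entire_gap (G : R -> C) : Prop :=
  (forall u, contC G u) /\
  exists h, entire h /\ Re_large (fun s => exists D,
    Clim (series_integral_gap G s) D /\ C_is_derive h s D).

Lemma Mellin_integrand_cont G s u : (forall u, contC G u) -> 0 < u ->
  contC (fun u => G u * Rcpow u (- s) / u)%C u.
Proof.
move=> H u0; apply: contC_mult; first by apply: contC_mult => //; exact: cont_pos_Rcpow.
have : contC (fun u => RtoC (/ u)) u.
  apply: is_derC_cont (is_derC_RtoC (is_derive_inv (fun u => u) u 1 _ _)); last lra.
  exact: is_derive_id.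
move=> H1 P HP; have := H1 P; rewrite RtoC_inv; last lra.
move=> /(_ HP) H2.
have [e He] := H2.
have d0 : 0 < Rmin e u by apply: Rmin_pos => //; exact: cond_pos.
exists (mkposreal _ d0) => v /= Hv.
have Hv' : Rabs (v - u) < Rmin e u by exact: Hv.
have v0 : 0 < v by have := Rmin_r e u; move: Hv' => /Rabs_def2; lra.
rewrite -RtoC_inv; last lra.
by apply: He; apply: (ball_le u (Rmin e u)) => //; exact: Rmin_l.
Qed.

Lemma Mellin_is_int G s n : (forall u, contC G u) ->
  is_intC (fun u => G u * Rcpow u (- s) / u)%C 1 (INR n.+1)
    (intC (fun u => G u * Rcpow u (- s) / u)%C 1 (INR n.+1)).
Proof.
move=> H; apply: intC_correct; first exact: INR_S_ge1.
by move=> u Hu; apply: Mellin_integrand_cont => //; lra.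
Qed.

Lemma entire_gap_plus G1 G2 : entire_gap G1 -> entire_gap G2 ->
  entire_gap (fun u => G1 u + G2 u)%C.
Proof.
move=> [c1 [h1 [e1 [A1 H1]]]] [c2 [h2 [e2 [A2 H2]]]].
split; first by move=> u; apply: contC_plus.
exists (fun z => h1 z + h2 z)%C; split.
  move=> z; have [l1 L1] := e1 z; have [l2 L2] := e2 z.
  by exists (l1 + l2)%C; exact: C_is_derive_plus.
exists (Rmax A1 A2) => s Hs.
have [D1 [L1 d1]] := H1 s (Rle_lt_trans _ _ _ (Rmax_l _ _) Hs).
have [D2 [L2 d2]] := H2 s (Rle_lt_trans _ _ _ (Rmax_r _ _) Hs).
exists (D1 + D2)%C; split; last exact: C_is_derive_plus.
apply: Clim_ext (Clim_plus L1 L2) => n; rewrite /series_integral_gap.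
have I := is_intC_plus (@Mellin_is_int _ s n c1) (@Mellin_is_int _ s n c2).
rewrite (@Csum_ext (fun m => (G1 (INR m.+1) + G2 (INR m.+1)) * Rcpow (INR m.+1) (- s - 1))%C
  (fun m => G1 (INR m.+1) * Rcpow (INR m.+1) (- s - 1)
    + G2 (INR m.+1) * Rcpow (INR m.+1) (- s - 1))%C); last by move=> m; ring.
rewrite Csum_plus.
have -> : intC (fun u => (G1 u + G2 u) * Rcpow u (- s) / u)%C 1 (INR n.+1)
  = (intC (fun u => G1 u * Rcpow u (- s) / u) 1 (INR n.+1)
     + intC (fun u => G2 u * Rcpow u (- s) / u) 1 (INR n.+1))%C.
  by apply: intC_unique; apply: is_intC_ext I => t; rewrite /Cdiv; ring.
ring.
Qed.

Lemma entire_gap_scal c G : entire_gap G -> entire_gap (fun u => c * G u)%C.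
Proof.
move=> [c1 [h1 [e1 [A1 H1]]]].
split; first by move=> u; apply: contC_mult; [exact: contC_const | exact: c1].
exists (fun z => c * h1 z)%C; split.
  by move=> z; have [l1 L1] := e1 z; exists (c * l1)%C; exact: C_is_derive_scal.
exists A1 => s Hs.
have [D1 [L1 d1]] := H1 s Hs.
exists (c * D1)%C; split; last exact: C_is_derive_scal.
apply: Clim_ext (Clim_scal c L1) => n; rewrite /series_integral_gap.
have I := is_intC_scal (c := c) (@Mellin_is_int _ s n c1).
rewrite (@Csum_ext (fun m => c * G (INR m.+1) * Rcpow (INR m.+1) (- s - 1))%C
  (fun m => c * (G (INR m.+1) * Rcpow (INR m.+1) (- s - 1)))%C); last by move=> m; ring.
rewrite Csum_scal.
have -> : intC (fun u => c * G u * Rcpow u (- s) / u)%C 1 (INR n.+1)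
  = (c * intC (fun u => G u * Rcpow u (- s) / u) 1 (INR n.+1))%C.
  by apply: intC_unique; apply: is_intC_ext I => t; rewrite /Cdiv; ring.
ring.
Qed.

Lemma entire_gap_ext G1 G2 : (forall u, G1 u = G2 u) -> entire_gap G1 -> entire_gap G2.
Proof. by move=> /FunctionalExtensionality.functional_extensionality ->. Qed.

Lemma entire_gap_0 : entire_gap (fun=> RtoC 0).
Proof.
split; first by move=> u; exact: contC_const.
exists (fun=> RtoC 0); split; first by move=> z; exists (RtoC 0); exact: C_is_derive_const.
exists 0 => s _; exists (RtoC 0); split; last exact: C_is_derive_const.
apply: Clim_ext (Clim_const _) => n; rewrite /series_integral_gap.
have I := is_intC_scal (c := 0) (@Mellin_is_int (fun=> RtoC 0) s n (fun u => @contC_const (RtoC 0) u)).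
rewrite (@Csum_ext (fun m => 0 * Rcpow (INR m.+1) (- s - 1))%C (fun=> 0 * 0)%C) => [|m]; last by ring.
rewrite Csum_scal (intC_unique (l := RtoC 0)); first by ring.
rewrite Cmult_0_l in I.
by apply: is_intC_ext I => t; rewrite /Cdiv; ring.
Qed.

Lemma entire_gap_sum (I : Type) (r : seq I) (G : I -> R -> C) :
  (forall i, entire_gap (G i)) ->
  entire_gap (fun u => \big[Cplus/RtoC 0]_(i <- r) G i u).
Proof.
move=> H; elim: r => [|i r IH].
  by apply: entire_gap_ext entire_gap_0 => u; rewrite big_nil.
by apply: entire_gap_ext (entire_gap_plus (H i) IH) => u; rewrite big_cons.
Qed.

(** * Exponential monomials *)

Definition phase (theta u : R) : C := Cexp (u * (Ci * theta)).

Lemma phase_cont theta u : contC (phase theta) u.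
Proof. exact: is_derC_cont (is_derive_Cexp_line _ _). Qed.

Lemma phase_add theta u v : phase theta (u + v) = (phase theta u * phase theta v)%C.
Proof. by rewrite /phase -Cexp_add RtoC_plus; congr Cexp; ring. Qed.

Lemma Cmod_phase theta u : Cmod (phase theta u) = 1.
Proof.
rewrite /phase Cmod_Cexp -exp_0; congr exp.
by rewrite /Re /Ci /Cmult /RtoC /=; ring.
Qed.

Lemma phase_INR theta m : phase theta (INR m) = (phase theta 1 ^ m)%C.
Proof.
elim: m => [|m IH].
  by rewrite /phase /= Cmult_0_l Cexp_0.
by rewrite S_INR phase_add IH Cpow_S; ring.
Qed.

(** Here the bound on the frequencies enters. For a nonzero integer frequency z = 1 too,
but the integral of e^(i theta t) over a period is 0 and would not balance p = 1: the
pole of the series would have no counterpart in the integral. *)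
Lemma phase_eq1 theta : - (2 * PI) < theta < 2 * PI -> phase theta 1 = 1 -> theta = 0.
Proof.
move=> Ht E.
have C1 : cos theta = 1.
  have := f_equal Re E; rewrite /phase /Cexp.
  have -> : Re (1 * (Ci * theta)) = 0 by rewrite /Re /Ci /Cmult /RtoC /=; ring.
  have -> : Im (1 * (Ci * theta)) = theta by rewrite /Im /Ci /Cmult /RtoC /=; ring.
  by rewrite exp_0 Rmult_1_l.
have S0 : sin (theta / 2) = 0.
  have := cos_2a_sin (theta / 2); have -> : 2 * (theta / 2) = theta by field.
  by rewrite C1; nra.
have [H|[H|H]] := Rtotal_order theta 0; [|done|].
- have := sin_gt_0 (- (theta / 2)) ltac:(lra) ltac:(lra).
  by rewrite sin_neg; lra.
- have := sin_gt_0 (theta / 2) ltac:(lra) ltac:(lra); lra.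
Qed.

Lemma phase_balanced theta : - (2 * PI) < theta < 2 * PI ->
  balanced (phase theta 1) 1 (fun t => - (1) * phase theta t)%C.
Proof.
move=> Ht; split.
  by move=> t; apply: contC_mult; [exact: contC_const | exact: phase_cont].
move=> /(phase_eq1 Ht) ->.
have I : is_intC (fun=> (- (1))%C) 0 1 (- (1))%C.
  have := is_RInt_const 0 1 ((- (1))%C : C_R_NormedModule).
  have -> : @scal R_AbsRing C_R_NormedModule (1 - 0)%R (- (1))%C = (- (1))%C.
    rewrite Rminus_0_r; exact: (@scal_one R_AbsRing C_R_NormedModule).
  by [].
rewrite (intC_unique (l := (- (1))%C)); first by ring.
by apply: is_intC_ext I => t; rewrite /phase !Cmult_0_r Cexp_0; ring.
Qed.

Lemma Rcpow_add u v w : Rcpow u (v + w) = (Rcpow u v * Rcpow u w)%C.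
Proof. by rewrite /Rcpow -Cexp_add; congr Cexp; ring. Qed.

Lemma Rcpow_INR u j : 0 < u -> Rcpow u (INR j) = (RtoC u ^ j)%C.
Proof.
move=> u0; elim: j => [|j IH]; first by rewrite /Rcpow Cmult_0_l Cexp_0.
by rewrite S_INR RtoC_plus Rcpow_add IH /Rcpow Cmult_1_l Cexp_real exp_ln // Cpow_S; ring.
Qed.

Lemma phase_monomial_cont theta (j : nat) (u : R) :
  contC (fun u => phase theta u * RtoC u ^ j)%C u.
Proof.
apply: contC_mult; first exact: phase_cont.
elim: j => [|j IH]; first exact: contC_const.
apply: (@contC_ext (fun u : R => RtoC u * RtoC u ^ j)%C); first by move=> t; rewrite Cpow_S.
by apply: contC_mult => //; apply: is_derC_cont (is_derC_RtoC (@is_derive_id R_AbsRing u)).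
Qed.

(** Cutting the integral at the integers and using e^(i theta (m + 1 + t)) =
z z^m e^(i theta t). *)
Lemma series_integral_gap_phase theta (j : nat) (s : C) n (G := fun u => (phase theta u * RtoC u ^ j)%C) :
  series_integral_gap G s n =
  (phase theta 1 * cell_sum (phase theta 1) 1 (fun t => - (1) * phase theta t)
     (fun u => Rcpow u (- (s + (1 - INR j)))) n)%C.
Proof.
set w := (s + (1 - INR j))%C.
set z := phase theta 1.
have cG u : contC G u by exact: phase_monomial_cont.
have Gs u : 0 < u -> (G u * Rcpow u (- s - 1))%C = (phase theta u * Rcpow u (- w))%C.
  move=> u0; rewrite /G -Rcpow_INR // -Cmult_assoc -Rcpow_add; congr (_ * Rcpow _ _)%C.
  by rewrite /w; ring.
have Gi u : 0 < u -> (G u * Rcpow u (- s) / u)%C = (phase theta u * Rcpow u (- w))%C.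
  move=> u0; rewrite -Gs //.
  have -> : (- s - 1 = - (s + 1))%C by ring.
  by rewrite Rcpow_succ // /Cdiv; ring.
pose F u := (G u * Rcpow u (- s) / u)%C.
have IF a b : 0 < a -> a <= b -> is_intC F a b (intC F a b).
  by move=> a0 ab; apply: intC_correct => // t Ht; apply: Mellin_integrand_cont => //; lra.
rewrite /series_integral_gap -/F.
elim: n => [|n IH].
  rewrite /cell_sum !Csum0.
  have -> : intC F 1 (INR 1) = 0.
    by apply: intC_unique; exact: (@is_RInt_point C_R_NormedModule).
  ring.
have n1 := INR_S_ge1 n.
have E2 : INR n.+2 = INR n.+1 + 1 by exact: S_INR.
have -> : intC F 1 (INR n.+2) = (intC F 1 (INR n.+1) + intC F (INR n.+1) (INR n.+2))%C.
  apply: intC_unique; apply: (@is_RInt_Chasles C_R_NormedModule); apply: IF; lra.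
have -> : intC F (INR n.+1) (INR n.+2) =
   (z * z ^ n * intC (fun t => phase theta t * Rcpow (INR n.+1 + t) (- w)) 0 1)%C.
  apply: intC_unique.
  have cP t : contC (phase theta) t by exact: phase_cont.
  have I := is_intC_scal (c := (z * z ^ n)%C) (cell_is_int (m := n) cP (@cont_pos_Rcpow w)).
  have cF t : 0 <= t <= 1 -> contC (fun t => F (INR n.+1 + t)) t.
    by move=> Ht; apply: contC_translate; apply: Mellin_integrand_cont => //; lra.
  have J : is_intC (fun t => F (1 * t + INR n.+1)) 0 1 (intC F (INR n.+1) (INR n.+2)).
    have K := IF (INR n.+1) (INR n.+2) ltac:(lra) ltac:(lra).
    have := is_RInt_comp_lin (V := C_R_NormedModule) F 1 (INR n.+1) 0 1 (intC F (INR n.+1) (INR n.+2)).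
    rewrite Rmult_0_r Rmult_1_r Rplus_0_l (Rplus_comm 1) -E2 => /(_ K).
    apply: is_RInt_ext => t _; exact: (@scal_one R_AbsRing C_R_NormedModule).
  have -> : (z * z ^ n * intC (fun t => phase theta t * Rcpow (INR n.+1 + t) (- w)) 0 1)%C
     = intC F (INR n.+1) (INR n.+2); last by apply: IF; lra.
  rewrite -(intC_unique I); apply: intC_unique.
  apply: is_intC_ext_in Rle_0_1 _ J => t Ht.
  rewrite Rmult_1_l Rplus_comm /F Gi; last lra.
  by rewrite phase_add phase_INR Cpow_S -/z; ring.
rewrite CsumS Gs; last lra.
rewrite phase_INR /cell_sum CsumS -/(cell_sum z 1 _ _ n) -/z Cmult_plus_distr_l -IH Cpow_S.
rewrite /cell.
have -> : intC (fun t => - (1) * phase theta t * Rcpow (INR n.+1 + t) (- w))%C 0 1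
  = (- (1) * intC (fun t => phase theta t * Rcpow (INR n.+1 + t) (- w)) 0 1)%C.
  have cP t : contC (phase theta) t by exact: phase_cont.
  apply: intC_unique.
  have I := is_intC_scal (c := (- (1))%C) (cell_is_int (m := n) cP (@cont_pos_Rcpow w)).
  by apply: is_intC_ext I => t; ring.
ring.
Qed.

Lemma entire_gap_phase theta (j : nat) : - (2 * PI) < theta < 2 * PI ->
  entire_gap (fun u => phase theta u * RtoC u ^ j)%C.
Proof.
move=> Ht; split; first exact: phase_monomial_cont.
have [H [eH HH]] := cell_sum_primitive (Cmod_phase theta 1) (phase_balanced Ht).
exists (fun s => phase theta 1 * H (s + (1 - INR j)))%C; split.
  move=> s; have [l Hl] := eH (s + (1 - INR j))%C.
  by exists (phase theta 1 * l)%C; apply: C_is_derive_scal; apply: C_is_derive_translate.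
exists (INR j + 1) => s Hs.
have w2 : 2 < Re (s + (1 - INR j)).
  by move: Hs; rewrite /Re /=; lra.
have [l [L1 L2]] := HH _ w2.
exists (phase theta 1 * l)%C; split.
  by apply: Clim_ext (Clim_scal _ L1) => n; rewrite series_integral_gap_phase.
by apply: C_is_derive_scal; apply: C_is_derive_translate.
Qed.

(** The factor cos(pi u) contributes the frequencies 1/2 and -1/2, i.e. theta = pi
and - pi. *)
Lemma entire_gap_canonical_extension M N : canonical_extension M N ->
  entire_gap (fun u => N (RtoC u)).
Proof.
move=> [d [T [I [t [s [_ HI _ EN]]]]]].
have P0 := PI_RGT_0.
apply: entire_gap_ext (fun u => esym (EN (RtoC u))) _.
apply: entire_gap_plus.
  apply: (@entire_gap_sum _ _ (fun (j : 'I_d.+1) u => \big[Cplus/RtoC 0]_(a <- I)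
      (t j a * Cexp (2 * PI * Ci * Q2R a * RtoC u) * RtoC u ^ j)%C)) => j.
  elim: I HI {EN} => [|a I IH] HI.
    by apply: entire_gap_ext entire_gap_0 => u; rewrite big_nil.
  have Ha := HI a (or_introl erefl).
  have Hph : - (2 * PI) < 2 * PI * Q2R a < 2 * PI by nra.
  apply: entire_gap_ext (entire_gap_plus
    (entire_gap_scal (t j a) (entire_gap_phase j Hph)) (IH _)).
    move=> u; rewrite big_cons; congr (_ + _)%C; rewrite /phase Cmult_assoc.
    by congr (_ * Cexp _ * _)%C; rewrite !RtoC_mult; ring.
  by move=> b Hb; apply: HI; right.
apply: (@entire_gap_ext (fun u => \big[Cplus/RtoC 0]_(j < d.+1)
   ((s j / 2) * (phase PI u * RtoC u ^ j) + (s j / 2) * (phase (- PI) u * RtoC u ^ j)))%C).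
  move=> u; rewrite big_distrr; apply: eq_bigr => j _ /=.
  rewrite /Ccos /phase.
  have -> : (RtoC u * (Ci * PI) = Ci * (PI * u))%C by ring.
  have -> : (RtoC u * (Ci * (- PI)%R) = - (Ci * (PI * u)))%C by rewrite RtoC_opp; ring.
  by rewrite /Cdiv; ring.
apply: (@entire_gap_sum _ _ (fun (j : 'I_d.+1) u => ((s j / 2) * (phase PI u * RtoC u ^ j)
   + (s j / 2) * (phase (- PI) u * RtoC u ^ j))%C)) => j.
by apply: entire_gap_plus; apply: entire_gap_scal; apply: entire_gap_phase; lra.
Qed.

(** * The ratio of the zeta functions *)

Lemma Clim_RInt_gen (F : R -> C) (l : C) :
  @is_RInt_gen C_R_NormedModule F (at_point 1) (Rbar_locally p_infty) l ->
  Clim (fun n => intC F 1 (INR n.+1)) l.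
Proof.
move=> H; apply: Clim_filterlim => P HP.
have [Q S HQ [M HS] HQS] := H P HP.
have [n0 Hn0] := INR_unbounded M.
exists n0 => n Hn.
have Hn' : M < INR n.+1.
  by have := le_INR _ _ Hn; rewrite S_INR; lra.
have [y [Hy Py]] := HQS 1 (INR n.+1) HQ (HS _ Hn').
by rewrite (intC_unique Hy).
Qed.

Lemma Cexp_surj (k : C) : k <> 0 -> exists z, Cexp z = k.
Proof.
move=> k0.
have m0 : 0 < Cmod k by exact: (proj1 (Cmod_gt_0 k)).
pose x := Re k / Cmod k; pose y := Im k / Cmod k.
have E : x ^ 2 + y ^ 2 = 1.
  rewrite /x /y; have := Cmod2_alt k => E2.
  have -> : (Re k / Cmod k) ^ 2 + (Im k / Cmod k) ^ 2 = (Re k ^ 2 + Im k ^ 2) / Cmod k ^ 2.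
    by field; lra.
  by rewrite -E2; field; lra.
have x1 : -1 <= x <= 1 by split; nra.
have S2 : sqrt (1 - Rsqr x) = Rabs y.
  by rewrite -sqrt_Rsqr_abs; congr sqrt; rewrite /Rsqr; lra.
have [th [c s]] : exists th, cos th = x /\ sin th = y.
  have [y0|y0] := Rle_lt_dec 0 y.
  - exists (acos x); rewrite cos_acos // sin_acos // S2; split => //.
    exact: Rabs_pos_eq.
  - exists (- acos x); rewrite cos_neg sin_neg cos_acos // sin_acos // S2; split => //.
    by rewrite Rabs_left //; ring.
exists (ln (Cmod k), th); rewrite /Cexp /= c s exp_ln //.
rewrite /x /y; case: (k) m0 => a b; rewrite /Re /Im /= => m0.
by congr pair; field; lra.
Qed.

(** A half-plane is convex: restrict to segments. *)
Lemma C_zero_derive_half_plane (f : C -> C) (A : R) :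
  (forall s, A < Re s -> C_is_derive f s 0) ->
  forall s0 s, A < Re s0 -> A < Re s -> f s = f s0.
Proof.
move=> H s0 s H0 H1.
pose g (t : R) := (s0 + t * (s - s0))%C.
have g0 : g 0 = s0 by rewrite /g; ring.
have g1 : g 1 = s by rewrite /g; ring.
rewrite -g0 -g1; symmetry.
apply: (@eq_is_derive C_R_NormedModule (fun t => f (g t)) 0 1); last lra.
move=> t Ht.
have dg : is_derC g t (s - s0)%C.
  apply/is_deriveP => e e0; exists 1; first lra.
  move=> h _.
  have -> : (g (t + h)%R - g t - h * (s - s0) = 0)%C by rewrite /g RtoC_plus; ring.
  by rewrite Cmod_0; apply: Rmult_le_pos; [lra | exact: Rabs_pos].
have R1 : A < Re (g t).
  have -> : Re (g t) = (1 - t) * Re s0 + t * Re s by rewrite /g /Re /=; ring.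
  pose d := Rmin (Re s0 - A) (Re s - A).
  have d0 : 0 < d by apply: Rmin_pos; lra.
  have := Rmult_le_compat_l t _ _ (proj1 Ht) (Rmin_r (Re s0 - A) (Re s - A)).
  have := Rmult_le_compat_l (1 - t) _ _ ltac:(lra) (Rmin_l (Re s0 - A) (Re s - A)).
  by rewrite -/d; lra.
apply: (is_derC_eq (is_derive_C_comp (H _ R1) dg)).
by rewrite Cmult_0_r.
Qed.

Lemma entire_opp h : entire h -> entire (fun z => - h z)%C.
Proof. by move=> H z; have [l Hl] := H z; exists (- l)%C; exact: C_is_derive_opp. Qed.

(** The logarithmic derivatives of the two zeta functions differ by h', so the
quotient times e^(-h) is locally constant. *)
Lemma zeta_log_derivative (N zeta zeta_disc h : C -> C) :
  is_zeta N zeta -> is_zeta_disc N zeta_disc ->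
  Re_large (fun s => exists D,
    Clim (series_integral_gap (fun u => N (RtoC u)) s) D /\ C_is_derive h s D) ->
  Re_large (fun s => [/\ zeta s <> 0, zeta_disc s <> 0 &
    C_is_derive (fun s => zeta s * / zeta_disc s * Cexp (- h s))%C s 0]).
Proof.
move=> [A1 H1] [A2 H2] [A3 H3].
exists (Rmax A1 (Rmax A2 A3)) => s Hs.
have [z0 [dz [l [Dz Il Ez]]]] := H1 s (Rle_lt_trans _ _ _ (Rmax_l _ _) Hs).
have Hs' := Rle_lt_trans _ _ _ (Rmax_r _ _) Hs.
have [d0 [dd [m [Dd Im Ed]]]] := H2 s (Rle_lt_trans _ _ _ (Rmax_l _ _) Hs').
have [D [LD Dh]] := H3 s (Rle_lt_trans _ _ _ (Rmax_r _ _) Hs').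
split => //.
have ED : D = (m - l)%C.
  apply: Clim_unique LD _.
  exact: Clim_minus (Clim_is_series Im) (Clim_RInt_gen Il).
have Ez' : dz = (- l * zeta s)%C by rewrite -Ez; field.
have Ed' : dd = (- m * zeta_disc s)%C by rewrite -Ed; field.
have := C_is_derive_mult (C_is_derive_mult Dz (C_is_derive_comp (g := zeta_disc) (C_is_derive_inv d0) Dd))
  (C_is_derive_comp (g := fun s => (- h s)%C) (C_is_derive_Cexp _) (C_is_derive_opp Dh)).
congr (C_is_derive _ _ _); rewrite Ez' Ed' ED; field.
exact: d0.
Qed.

(** * Singularities of continuations *)

Lemma Re_large_locally (P : C -> Prop) : Re_large P ->
  Re_large (fun s => locally s P).
Proof.
move=> [A H]; exists A => s Hs.
have d0 : 0 < Re s - A by lra.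
exists (mkposreal _ d0) => y [/= Hy _].
apply: H; move: Hy; rewrite /ball /= /AbsRing_ball /abs /minus /plus /opp /= => /Rabs_def2.
by rewrite /Re in d0 Hs *; lra.
Qed.

(** A nowhere vanishing entire factor multiplies every germ along the path. *)
Lemma continuation_mult_Cexp (D : R -> Prop) (f f' k : C -> C) (g : R -> C)
    (F : R -> C -> C) : entire k ->
  locally (g 0) (fun s => f' s = (f s * Cexp (k s))%C) ->
  continuation D f g F -> continuation D f' g (fun t s => F t s * Cexp (k s))%C.
Proof.
move=> ek E [H0 H1 H2]; split.
- by apply: filter_imp (filter_and _ _ E H0) => s [-> ->].
- move=> t /H1; apply: filter_imp => s [l Hl].
  have [m Hm] := ek s; eexists; apply: C_is_derive_mult; first exact: Hl.
  exact: C_is_derive_comp (C_is_derive_Cexp _) Hm.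
- move=> t /H2; apply: filter_imp => u Hu /Hu.
  by apply: filter_imp => s ->.
Qed.

Lemma singular_end_mult_Cexp (f f' k : C -> C) (g : R -> C) : entire k ->
  locally (g 0) (fun s => f' s = (f s * Cexp (k s))%C) ->
  singular_end f g <-> singular_end f' g.
Proof.
move=> ek E.
have E' : locally (g 0) (fun s => f s = (f' s * Cexp (- k s))%C).
  by apply: filter_imp E => s ->; rewrite -Cmult_assoc Cexp_opp Cmult_1_r.
have ek' := entire_opp ek.
split=> -[[F HF] nF]; split.
- by eexists; apply: continuation_mult_Cexp ek E HF.
- by move=> [F' HF']; apply: nF; eexists; apply: continuation_mult_Cexp ek' E' HF'.
- by eexists; apply: continuation_mult_Cexp ek' E' HF.
- by move=> [F' HF']; apply: nF; eexists; apply: continuation_mult_Cexp ek E HF'.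
Qed.

Theorem proposition5p1 (X : functor MR_cat)
    (hX : F1_scheme X) (noethX : F1_noetherian X)
    (N : C -> C) (hN : counting_function X N)
    (zeta zeta_disc : C -> C)
    (hzeta : is_zeta N zeta) (hzeta_disc : is_zeta_disc N zeta_disc) :
  same_singularities zeta zeta_disc /\
  exists h : C -> C,
    entire h /\ Re_large (fun s => (zeta s / zeta_disc s)%C = Cexp (h s)).
Proof.
have [M _ HM] := hN.
have [_ [h0 [eh0 gap]]] := entire_gap_canonical_extension HM.
have [A HA] := zeta_log_derivative hzeta hzeta_disc gap.
pose q s := (zeta s * / zeta_disc s * Cexp (- h0 s))%C.
pose s1 := RtoC (A + 1).
have Hs1 : A < Re s1 by rewrite /=; lra.
have qconst s : A < Re s -> q s = q s1.
  by move=> Hs; apply: (C_zero_derive_half_plane (A := A)) => // {Hs} s /HA [].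
have [c Hc] : exists c, Cexp c = q s1.
  apply: Cexp_surj; have [z0 d0 _] := HA s1 Hs1.
  apply: Cmult_neq_0; last exact: Cexp_neq0.
  apply: Cmult_neq_0 => // E; have := Cinv_r _ d0; rewrite E Cmult_0_r.
  by move=> /(f_equal fst) /=; lra.
pose h s := (c + h0 s)%C.
have eh : entire h.
  move=> z; have [l Hl] := eh0 z; exists (0 + l)%C.
  exact: C_is_derive_plus (C_is_derive_const _ _) Hl.
have ratio s : A < Re s -> (zeta s / zeta_disc s)%C = Cexp (h s).
  move=> Hs; rewrite /h Cexp_add Hc -(qconst s Hs) /q -!Cmult_assoc.
  by rewrite (Cmult_comm (Cexp (- _))) Cexp_opp Cmult_1_r.
split; last by exists h; split => //; exists A.
have /Re_large_locally [A' HA'] : Re_large (fun s => zeta_disc s = (zeta s * Cexp (- h s))%C).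
  exists A => s Hs; have [z0 d0 _] := HA s Hs.
  have -> : zeta s = (zeta s / zeta_disc s * zeta_disc s)%C by field.
  by rewrite ratio // -Cmult_assoc (Cmult_comm (zeta_disc s)) Cmult_assoc Cexp_opp Cmult_1_l.
exists A' => s Hs g _ gs.
apply: (singular_end_mult_Cexp (k := fun s => - h s)%C); first exact: entire_opp.
by rewrite gs; exact: HA'.
Qed.
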